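(* Let $\pi$ be a finitely refining sequence of partitions of $[0,1]$, let $a_0,a_1\in\mathbb R$, and let $\{\eta_{m,k}\}$ ($m\ge0$, $0\le k\le N(\pi^{m+1})-N(\pi^m)-1$) be real random variables on a probability space $(\Omega,\mathcal F,\mathbb P)$ with $\mathbb E\eta_{m,k}=0$, $\mathbb E[\eta_{m,k}\eta_{m',k'}]=\mathbb 1_{m=m'}\mathbb 1_{k=k'}$, $\sup_{m,k}\mathbb E\eta_{m,k}^4<\infty$, and $\mathbb E[\eta_{j_1}^{\alpha}\eta_{j_2}^{\beta}\eta_{j_3}^{\gamma}\eta_{j_4}^{\delta}]=\mathbb E[\eta_{j_1}^\alpha]\mathbb E[\eta_{j_2}^\beta]\mathbb E[\eta_{j_3}^\gamma]\mathbb E[\eta_{j_4}^\delta]$ for all pairwise distinct indices $j_1,\dots,j_4$ and nonnegative integers $\alpha+\beta+\gamma+\delta=4$. Define $x(t)=a_0+a_1t+\sum_{m=0}^\infty\sum_k\eta_{m,k}e^\pi_{m,k}(t)$ (limit in $L^2(\mathbb P)$ of the partial sums over $m$). Then for every $t\in[0,1]$ and $\epsilon>0$, $$\lim_{n\to\infty}\mathbb P\big(|[x]_{\pi^n}(t)-t|>\epsilon\big)=0.$$ If moreover $\pi$ is complete refining and balanced, then almost surely $x\in Q_\pi([0,1],\mathbb R)$ and $[x]_\pi(t)=t$ for all $t\in[0,1]$.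
   Context: A partition of $[0,1]$ is a finite set $\{0=t_0<t_1<\dots<t_N=1\}$; for a partition $\pi^n=\{0=t^n_0<\dots<t^n_{N(\pi^n)}=1\}$, $N(\pi^n)$ is its number of intervals, $|\pi^n|=\max_i(t^n_{i+1}-t^n_i)$ and $\underline{\pi^n}=\min_i(t^n_{i+1}-t^n_i)$. A sequence $\pi=(\pi^n)_{n\ge0}$ of partitions of $[0,1]$, with the convention $\pi^0=\{0,1\}$, is finitely refining if $\pi^n\subseteq\pi^{n+1}$ for all $n$, $|\pi^n|\to0$, and there is $M<\infty$ such that for every $n$ each interval $[t^n_i,t^n_{i+1}]$ contains at most $M$ points of $\pi^{n+1}$. It is balanced if $\sup_{n\ge1}|\pi^n|/\underline{\pi^n}<\infty$, and complete refining if there are $\epsilon>0$, $M'<\infty$ with $1+\epsilon\le|\pi^n|/|\pi^{n+1}|\le M'$ for all $n\ge1$. Haar and Schauder functions of a finitely refining $\pi$: for each level $m\ge0$ and each interval $[u_0,u_r]$ of $\pi^m$, let $u_0<u_1<\dots<u_r$ be the points of $\pi^{m+1}$ lying in $[u_0,u_r]$. For each $i\in\{2,\dots,r\}$ put $t_1=u_0$, $t_2=u_{i-1}$, $t_3=u_i$ and define $\psi(s)=\sqrt{\frac{t_3-t_2}{(t_2-t_1)(t_3-t_1)}}$ for $s\in[t_1,t_2)$, $\psi(s)=-\sqrt{\frac{t_2-t_1}{(t_3-t_2)(t_3-t_1)}}$ for $s\in[t_2,t_3)$, $\psi(s)=0$ otherwise, and $e(t)=\int_0^t\psi(s)\,ds$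 (a continuous hat function vanishing outside $[t_1,t_3]$, affine on $[t_1,t_2]$ and on $[t_2,t_3]$, maximal at $t_2$). Ranging over all intervals of $\pi^m$ and all such $i$ gives $N(\pi^{m+1})-N(\pi^m)$ functions at level $m$, enumerated in a fixed order as $\psi_{m,k}$, $e^\pi_{m,k}$, $k=0,\dots,N(\pi^{m+1})-N(\pi^m)-1$. Discrete quadratic variation: $[x]_{\pi^n}(t)=\sum_{i}(x(t^n_{i+1}\wedge t)-x(t^n_i\wedge t))^2$. $Q_\pi([0,1],\mathbb R)$ is the set of continuous $x:[0,1]\to\mathbb R$ such that $[x]_{\pi^n}$ converges uniformly on $[0,1]$, as $n\to\infty$, to a continuous nondecreasing function, denoted $[x]_\pi$. *)

(* Defs.v *)
From HB Require Import structures.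
From mathcomp Require Import all_boot all_order all_algebra.
From mathcomp Require Import all_classical all_reals all_analysis.
Set Implicit Arguments.
Unset Strict Implicit.
Unset Printing Implicit Defensive.
Import Order.TTheory GRing.Theory Num.Theory.
Import numFieldNormedType.Exports.
Local Open Scope classical_set_scope.
Local Open Scope ring_scope.

Section Defs.
Variable R : realType.

Definition is_partition (p : seq R) : Prop :=
  [/\ sorted <%R p, p`_0 = 0, last 0 p = 1 & (1 < size p)%N].

Definition nint (p : seq R) : nat := (size p).-1.

Definition mesh (p : seq R) : R :=
  \big[Num.max/0]_(i < nint p) (p`_i.+1 - p`_i).
Definition minstep (p : seq R) : R :=
  \big[Num.min/1]_(i < nint p) (p`_i.+1 - p`_i).

Definition finitely_refining (pi : nat -> seq R) : Prop :=
  [/\ forall n, is_partition (pi n),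
      pi 0%N = [:: 0; 1],
      forall n, {subset pi n <= pi n.+1},
      mesh (pi n) @[n --> \oo] --> 0 &
      exists M : nat, forall n (i : nat), (i < nint (pi n))%N ->
        leq (count (fun s => ((pi n)`_i <= s) && (s <= (pi n)`_i.+1)) (pi n.+1))
          M ].

Definition balanced (pi : nat -> seq R) : Prop :=
  exists C : R, forall n, (0 < n)%N -> mesh (pi n) <= C * minstep (pi n).

Definition complete_refining (pi : nat -> seq R) : Prop :=
  exists (eps M' : R), 0 < eps /\ forall n, (0 < n)%N ->
    1 + eps <= mesh (pi n) / mesh (pi n.+1) <= M'.

Definition nlev (pi : nat -> seq R) (m : nat) : nat :=
  (nint (pi m.+1) - nint (pi m))%N.

(* The level-m functions are indexed by the points of pi^{m+1} \ pi^m,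
   listed in increasing order (this is the "fixed order" of enumeration):
   the k-th new point s is t2; t1 is the left endpoint of the interval of
   pi^m containing s; t3 is the successor of s in pi^{m+1}. *)
Definition newpts (pi : nat -> seq R) (m : nat) : seq R :=
  [seq s <- pi m.+1 | s \notin pi m].

Definition ht2 pi m k : R := (newpts pi m)`_k.
Definition ht1 pi m k : R :=
  \big[Num.max/0]_(u <- pi m | u < ht2 pi m k) u.
Definition ht3 pi m k : R :=
  (pi m.+1)`_(index (ht2 pi m k) (pi m.+1)).+1.

Definition haar (t1 t2 t3 : R) (s : R) : R :=
  if (t1 <= s) && (s < t2) then Num.sqrt ((t3 - t2) / ((t2 - t1) * (t3 - t1)))
  else if (t2 <= s) && (s < t3) then
    - Num.sqrt ((t2 - t1) / ((t3 - t2) * (t3 - t1)))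
  else 0.

Definition psi pi m k : R -> R := haar (ht1 pi m k) (ht2 pi m k) (ht3 pi m k).

Definition schauder pi m k (t : R) : R :=
  (\int[@lebesgue_measure R]_(s in `[0, t]) psi pi m k s)%R.

Definition dqv (p : seq R) (x : R -> R) (t : R) : R :=
  \sum_(i < nint p) (x (Num.min p`_i.+1 t) - x (Num.min p`_i t)) ^+ 2.

Definition qv_limit (pi : nat -> seq R) (x : R -> R) (A : R -> R) : Prop :=
  [/\ {within `[0, 1], continuous A},
      {in `[0, 1] &, {homo A : s t / s <= t}} &
      forall e : R, 0 < e -> exists N : nat, forall n, (N <= n)%N ->
        forall t, t \in `[0, 1] -> `|dqv (pi n) x t - A t| < e ].

Definition inQ (pi : nat -> seq R) (x : R -> R) : Prop :=
  {within `[0, 1], continuous x} /\ exists A, qv_limit pi x A.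

Definition partial_sum {T} pi (a0 a1 : R) (eta : nat -> nat -> T -> R)
  (M : nat) (t : R) (w : T) : R :=
  a0 + a1 * t + \sum_(m < M) \sum_(k < nlev pi m) eta m k w * schauder pi m k t.

End Defs.

(* Main.v *)
Require Import Defs.
From HB Require Import structures.
From mathcomp Require Import all_boot all_order all_algebra.
From mathcomp Require Import all_classical all_reals all_analysis.
From mathcomp Require Import measurable_realfun ring lra zify.
Import Order.TTheory GRing.Theory Num.Theory.
Import numFieldNormedType.Exports.
Local Open Scope classical_set_scope.
Local Open Scope ring_scope.

(** Write x_M for the partial sums.  Inserting the points of pi^{m+1} \ pi^m one
    at a time, Bessel's identity telescopes to
      sum_{m < M, k} e_{m,k}(s) e_{m,k}(t) = G_M(s, t) - s t,
    where G_M is the covariance of Brownian motion projected onto the step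
    functions of pi^M.  Hence, for M >= n, the covariance matrix of the stochastic
    part of the increments of x_M over pi^n stopped at t is diagonal up to a rank
    one perturbation, with trace t + O(|pi^n|) and squared Frobenius norm
    O(|pi^n|).  The fourth moment assumptions bound the variance of a quadratic
    form in the eta's by a multiple of the squared Frobenius norm of its matrix, so
      E ([x_M]_{pi^n}(t) - t)^2 <= K |pi^n|,  uniformly in M >= n,
    and letting M tend to infinity gives convergence in probability.

    If pi is balanced and complete refining, |pi^n| decays geometrically, so
    [x]_{pi^n}(t) tends to t almost surely at every partition point t, where x is a
    finite sum.  Fourth moments also give |eta_{m,k}| |e_{m,k}| <= B kap^m almost
    surely with kap < 1; since boundedly many hats of each level overlap, the series
    converges uniformly and its sum is a continuous version of x.  Monotonicity of
    the quadratic variation (Polya's argument) upgrades convergence at partition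
    points to uniform convergence. *)

(** * Hat functions *)

Section Ramp.
Context {R : realType}.
Implicit Types a b c s t : R.

(** For [a <= b], the integral up to [s] of the indicator of [[a, b)]. As a difference of minima it
    makes splitting and telescoping purely algebraic. *)
Definition ramp a b s : R := Num.min b s - Num.min a s.

Definition hat t1 t2 t3 s : R :=
  Num.sqrt ((t3 - t2) / ((t2 - t1) * (t3 - t1))) * ramp t1 t2 s
  - Num.sqrt ((t2 - t1) / ((t3 - t2) * (t3 - t1))) * ramp t2 t3 s.

Lemma ramp_split a b c s : ramp a c s = ramp a b s + ramp b c s.
Proof. by rewrite /ramp; ring. Qed.

Lemma ramp_le a b s : a <= b -> s <= a -> ramp a b s = 0.
Proof. by move=> ab sa; rewrite /ramp !min_r ?subrr ?(le_trans sa). Qed.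

Lemma ramp_ge a b s : a <= b -> b <= s -> ramp a b s = b - a.
Proof. by move=> ab bs; rewrite /ramp !min_l ?(le_trans ab). Qed.

Lemma ramp_mid a b s : a <= s <= b -> ramp a b s = s - a.
Proof. by case/andP=> sa sb; rewrite /ramp min_r // min_l. Qed.

Lemma ramp_itv a b s : a <= b -> 0 <= ramp a b s <= b - a.
Proof.
move=> ab; have [sa|sa] := leP s a; first by rewrite ramp_le // lexx; lra.
have [sb|sb] := leP s b; first by rewrite ramp_mid; lra.
by rewrite ramp_ge ?(ltW sb) // lexx; lra.
Qed.

Lemma ramp_homo a b s t : a <= b -> s <= t -> ramp a b s <= ramp a b t.
Proof.
move=> ab st; have [sa|sa] := leP s a.
  by rewrite (ramp_le a) //; have := ramp_itv a b t ab; lra.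
have [tb|tb] := leP t b; first by rewrite !ramp_mid; lra.
by rewrite (ramp_ge a b t) ?(ltW tb) //; have := ramp_itv a b s ab; lra.
Qed.

Lemma hat_le t1 t2 t3 s : t1 <= t2 -> t2 <= t3 -> s <= t1 -> hat t1 t2 t3 s = 0.
Proof. by move=> h1 h2 hs; rewrite /hat !ramp_le //; lra. Qed.

(** The rise of a hat over one leg, slope times length, in a form symmetric in the two legs: the
    fall over the other leg cancels it exactly. *)
Lemma sqrt_ratioM (p q : R) : 0 < p -> 0 < q ->
  Num.sqrt (q / (p * (p + q))) * p = Num.sqrt (p * q / (p + q)).
Proof.
move=> p0 q0; rewrite -[X in _ * X = _](gtr0_norm p0) -sqrtr_sqr -sqrtrM; last first.
  by rewrite divr_ge0 ?mulr_ge0 //; lra.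
by congr Num.sqrt; field; lra.
Qed.

Lemma hat_ge t1 t2 t3 s : t1 < t2 -> t2 < t3 -> t3 <= s -> hat t1 t2 t3 s = 0.
Proof.
move=> h1 h2 hs; rewrite /hat !ramp_ge; try lra.
have -> : t3 - t1 = (t2 - t1) + (t3 - t2) by ring.
rewrite sqrt_ratioM; try lra.
rewrite [t2 - t1 + _]addrC sqrt_ratioM; try lra.
by rewrite [(t3 - t2) * _]mulrC subrr.
Qed.

(* The peak has height sqrt (p q / (p + q)), where p and q are the lengths of the
   two legs. *)
Lemma hat_bound t1 t2 t3 s : t1 < t2 -> t2 < t3 ->
  `|hat t1 t2 t3 s| <= Num.sqrt (t3 - t2).
Proof.
move=> h1 h2; set p := t2 - t1; set q := t3 - t2.
have p0 : 0 < p by rewrite /p; lra.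
have q0 : 0 < q by rewrite /q; lra.
have r_ : t3 - t1 = p + q by rewrite /p /q; ring.
set m := Num.sqrt (p * q / (p + q)).
have mq : m <= Num.sqrt q.
  rewrite ler_wsqrtr // ler_pdivrMr; last lra.
  by have := mulr_gt0 q0 q0; nra.
have e1 : Num.sqrt (q / (p * (p + q))) * p = m by exact: sqrt_ratioM.
have e2 : Num.sqrt (p / (q * (p + q))) * q = m.
  by rewrite /m [p + q]addrC [p * q]mulrC sqrt_ratioM.
rewrite (le_trans _ mq) // /hat r_ -/p -/q.
set c := Num.sqrt (q / _) in e1 *; set d := Num.sqrt (p / _) in e2 *.
have c0 : 0 <= c by exact: sqrtr_ge0.
have d0 : 0 <= d by exact: sqrtr_ge0.
have := ramp_itv t1 t2 s (ltW h1); have := ramp_itv t2 t3 s (ltW h2).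
rewrite -/p -/q => /andP[b0 bq] /andP[a0 ap].
have ca : c * ramp t1 t2 s <= m by rewrite -e1 ler_wpM2l.
have db : d * ramp t2 t3 s <= m by rewrite -e2 ler_wpM2l.
have ca0 : 0 <= c * ramp t1 t2 s by exact: mulr_ge0.
have db0 : 0 <= d * ramp t2 t3 s by exact: mulr_ge0.
by rewrite ler_norml; lra.
Qed.

(** For [0 <= a < b], the product of the coefficients of the indicators of [[0, s]] and [[0, t]]
    along the normalised indicator of [[a, b)]. *)
Definition gramt s t a b : R := ramp a b s * ramp a b t / (b - a).

(* Bessel's identity for the orthogonal splitting of the constant function on
   [t1, t3) into constants on [t1, t2) and [t2, t3). *)
Lemma gramt_split t1 t2 t3 s t : t1 < t2 -> t2 < t3 ->
  gramt s t t1 t2 + gramt s t t2 t3 =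
  hat t1 t2 t3 s * hat t1 t2 t3 t + gramt s t t1 t3.
Proof.
move=> h1 h2; rewrite /gramt !(ramp_split t1 t2 t3) /hat.
have r_ : t3 - t1 = (t2 - t1) + (t3 - t2) by ring.
rewrite !r_; set p := t2 - t1; set q := t3 - t2.
have p0 : 0 < p by rewrite /p; lra.
have q0 : 0 < q by rewrite /q; lra.
set c := Num.sqrt (q / _); set d := Num.sqrt (p / _).
have cc : c * c = q / (p * (p + q)).
  by rewrite -expr2 sqr_sqrtr // divr_ge0 ?mulr_ge0 //; lra.
have dd : d * d = p / (q * (p + q)).
  by rewrite -expr2 sqr_sqrtr // divr_ge0 ?mulr_ge0 //; lra.
have cd : c * d = (p + q)^-1.
  rewrite /c /d -sqrtrM ?divr_ge0 ?mulr_ge0 //; try lra.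
  rewrite (_ : _ * _ = (p + q)^-1 ^+ 2); last by field; lra.
  by rewrite sqrtr_sqr gtr0_norm // invr_gt0; lra.
set a := ramp t1 t2 s; set a' := ramp t1 t2 t.
set b := ramp t2 t3 s; set b' := ramp t2 t3 t.
(* The square roots enter only through [c * c], [d * d] and [c * d], which are rational in [p] and
   [q]. *)
rewrite [(c * a - d * b) * _](_ : _ =
  (c * c) * (a * a') + (d * d) * (b * b') - (c * d) * (a * b' + b * a')); last by ring.
by rewrite cc dd cd; field; lra.
Qed.

(** * Lebesgue integrals of Haar functions *)

Lemma integral_indic_ramp a b t : 0 <= a -> a <= b ->
  (\int[@lebesgue_measure R]_(s in `[0%R, t]) (\1_(`[a, b[%classic) s)%:E
   = (ramp a b t)%:E)%E.
Proof.
move=> a0 ab; rewrite integral_indic //=.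
have [ta|ta] := ltP t a.
  rewrite ramp_le ?(ltW ta) // (_ : _ `&` _ = set0) ?measure0 //.
  rewrite -subset0 => x /=; rewrite !in_itv /= => -[/andP[h1 h2] /andP[h3 h4]].
  lra.
have [tb|tb] := ltP t b.
  rewrite ramp_mid ?ta ?(ltW tb) // (_ : _ `&` _ = `[a, t]%classic).
    by rewrite lebesgue_measure_itv /= lte_fin; case: ltP => // at_; congr EFin; lra.
  apply/seteqP; split => x /=; rewrite !in_itv /=.
    by move=> [/andP[h1 h2] /andP[h3 h4]]; lra.
  by move=> /andP[h1 h2]; split; lra.
rewrite ramp_ge // (_ : _ `&` _ = `[a, b[%classic).
  by rewrite lebesgue_measure_itv /= lte_fin; case: ltP => // at_; congr EFin; lra.
apply/seteqP; split => x /=; rewrite !in_itv /=.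
  by move=> [/andP[h1 h2] /andP[h3 h4]]; lra.
by move=> /andP[h1 h2]; split; lra.
Qed.

Lemma integrable_indic_itv a b t :
  (@lebesgue_measure R).-integrable `[0, t] (EFin \o \1_(`[a, b[%classic : set R)).
Proof.
apply/integrableP; split; first by apply/measurable_EFinP; exact: measurable_indic.
under eq_integral => x _ do rewrite gee0_abs ?lee_fin //.
rewrite integral_indic //=.
apply: (@le_lt_trans _ _ (lebesgue_measure `[a, b[%classic)).
  by apply: le_measure; rewrite ?inE //; exact: measurableI.
by rewrite lebesgue_measure_itv /=; case: ifP => //; rewrite ltry.
Qed.

Lemma Rintegral_haar t1 t2 t3 t : 0 <= t1 -> t1 <= t2 -> t2 <= t3 ->
  \int[@lebesgue_measure R]_(s in `[0, t]) haar t1 t2 t3 s = hat t1 t2 t3 t.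
Proof.
move=> h0 h1 h2; pose c := Num.sqrt ((t3 - t2) / ((t2 - t1) * (t3 - t1))).
pose d := Num.sqrt ((t2 - t1) / ((t3 - t2) * (t3 - t1))).
transitivity (\int[@lebesgue_measure R]_(s in `[0, t])
  (c * \1_(`[t1, t2[%classic) s - d * \1_(`[t2, t3[%classic) s)).
  apply: eq_Rintegral => s _; rewrite /haar !indicE !mem_setE /= !in_itv /= -/c -/d.
  case: (leP t1 s) => a1 /=; case: (ltP s t2) => a2 /=; case: (ltP s t3) => a3 /=;
   rewrite ?mulr1 ?mulr0 ?subr0 ?sub0r ?oppr0 //; lra.
have i1 := integrable_indic_itv t1 t2 t.
have i2 := integrable_indic_itv t2 t3 t.
have Z (k : R) (A : set R) :
   (@lebesgue_measure R).-integrable `[0, t] (EFin \o \1_A) ->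
   (@lebesgue_measure R).-integrable `[0, t] (EFin \o (fun s => k * \1_A s)).
  by move=> iA; under [EFin \o _]funext do rewrite /= EFinM; exact: integrableZl.
rewrite RintegralB //; [|exact: Z|exact: Z].
rewrite !RintegralZl // /Rintegral !integral_indic_ramp //.
by rewrite (le_trans h0).
Qed.

End Ramp.

(** * Refinement of partitions and the covariance of the partial sums *)

Section Partitions.
Context {R : realType}.
Implicit Types (p q : seq R) (a b u v w s t : R).

(** [leftpt] and [rightpt] are the expressions in [ht1] and [ht3], taken as functions of the peak
    itself, so that sums over the index [k] become sums over new points. *)
Definition leftpt p u : R := \big[Num.max/0]_(v <- p | v < u) v.
Definition rightpt q u : R := q`_(index u q).+1.

Lemma mem_nth_part p i : is_partition p -> (i <= nint p)%N -> p`_i \in p.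
Proof. by move=> [_ _ _ p1] ip; rewrite mem_nth //; move: ip p1; rewrite /nint; case: (size p). Qed.

Lemma nth_part_lt p i j : is_partition p -> (j <= nint p)%N -> (i < j)%N ->
  p`_i < p`_j.
Proof.
move=> [sp _ _ p1] jp ij; rewrite lt_sorted_ltn_nth // inE.
  by rewrite (ltn_trans ij) //; move: jp p1; rewrite /nint; case: (size p).
by move: jp p1; rewrite /nint; case: (size p).
Qed.

Lemma nth_part_le p i j : is_partition p -> (j <= nint p)%N -> (i <= j)%N ->
  p`_i <= p`_j.
Proof.
by move=> pp jp; rewrite leq_eqVlt => /predU1P[->//|ij]; rewrite ltW ?nth_part_lt.
Qed.

Lemma nth_part0 p : is_partition p -> p`_0 = 0.
Proof. by case. Qed.

Lemma nth_part1 p : is_partition p -> p`_(nint p) = 1.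
Proof. by move=> [_ _ l1 _]; rewrite /nint nth_last. Qed.

Lemma nint_gt0 p : is_partition p -> (0 < nint p)%N.
Proof. by case=> _ _ _; rewrite /nint; case: p => [|? []]. Qed.

Lemma part_index p u : is_partition p -> u \in p ->
  (index u p <= nint p)%N /\ p`_(index u p) = u.
Proof.
move=> pp up; split; last exact: nth_index.
by move: up; rewrite -index_mem /nint; case: (size p).
Qed.

Lemma mem0_part p : is_partition p -> 0 \in p.
Proof. by move=> pp; rewrite -(nth_part0 _ pp) mem_nth_part. Qed.

Lemma mem1_part p : is_partition p -> 1 \in p.
Proof. by move=> pp; rewrite -(nth_part1 _ pp) mem_nth_part. Qed.

Lemma part_itv p u : is_partition p -> u \in p -> 0 <= u <= 1.
Proof.
move=> pp up; have [i1 <-] := part_index _ _ pp up.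
by rewrite -{1}(nth_part0 _ pp) -(nth_part1 _ pp) !nth_part_le.
Qed.

Lemma part_consecutive p u i : is_partition p -> u \in p -> (i < nint p)%N ->
  u <= p`_i \/ p`_i.+1 <= u.
Proof.
move=> pp up ip; have [i1 <-] := part_index _ _ pp up.
by case: (leqP (index u p) i) => h; [left|right]; rewrite nth_part_le // ltnW.
Qed.

Lemma part_locate p t : is_partition p -> 0 <= t <= 1 ->
  exists2 i, (i < nint p)%N & p`_i <= t <= p`_i.+1.
Proof.
move=> pp /andP[t0 t1].
have ex : exists i, (i < nint p)%N && (t <= p`_i.+1).
  by exists (nint p).-1; rewrite prednK ?nint_gt0 // nth_part1 // leqnn.
case: (ex_minnP ex) => i /andP[ip ti] mini; exists i => //; rewrite ti andbT.
case: i ip ti mini => [|i] ip ti mini; first by rewrite nth_part0.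
rewrite leNgt; apply/negP => ti'; have := mini i.
by rewrite (ltn_trans _ ip) // ltW // ltnn => /(_ isT).
Qed.

Lemma leftptP p u : is_partition p -> 0 < u ->
  [/\ leftpt p u \in p, leftpt p u < u & forall x, x \in p -> x < u -> x <= leftpt p u].
Proof.
move=> pp u0.
have : (leftpt p u \in p) /\ leftpt p u < u.
  rewrite /leftpt big_seq_cond.
  elim/big_ind: _ => [||i /andP[]//]; first by rewrite mem0_part.
  by move=> x y [? ?] [? ?]; case: (leP x y).
by case=> ? ?; split=> // x xp xu; exact: le_bigmax_seq.
Qed.

Lemma rightptP q u : is_partition q -> u \in q -> u < 1 ->
  [/\ rightpt q u \in q, u < rightpt q u & forall x, x \in q -> u < x -> rightpt q u <= x].
Proof.
move=> pq uq u1; have [i1 e] := part_index _ _ pq uq.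
have i2 : (index u q < nint q)%N.
  rewrite ltn_neqAle i1 andbT; apply/eqP => i2.
  by move: u1; rewrite -e i2 nth_part1 ?ltxx.
rewrite /rightpt; split; first by rewrite mem_nth_part.
  by rewrite -{1}e nth_part_lt.
move=> x xq ux; have [] := part_consecutive _ _ _ pq xq i2 => //.
by rewrite e leNgt ux.
Qed.

(** Sums over neighbouring points in recursive form, suited to induction over inserted points;
    [adjsumE] leads back to indexed sums. *)
Fixpoint adjsum (F : R -> R -> R) a l : R :=
  if l is b :: l' then F a b + adjsum F b l' else 0.

Lemma adjsum_cons F a b l : adjsum F a (b :: l) = F a b + adjsum F b l.
Proof. by []. Qed.

Lemma adjsumE F a l :
  \sum_(i < nint (a :: l)) F (a :: l)`_i (a :: l)`_i.+1 = adjsum F a l.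
Proof.
elim: l a => [|b l IH] a; first by rewrite big_ord0.
by rewrite /nint /= big_ord_recl /= -IH.
Qed.

Lemma pairwise_consecutive pre v w l x :
  pairwise <%R (pre ++ v :: w :: l) -> x \in pre ++ v :: w :: l ->
  [/\ v < w, x < w -> x <= v & v < x -> w <= x].
Proof.
rewrite pairwise_cat /= => /and3P[/allrelP rel _].
move=> /andP[/andP[vw /allP vl] /andP[/allP wl _]].
rewrite mem_cat !inE => /or4P[xpre|/eqP->|/eqP->|xl]; split=> //.
- by move=> _; rewrite ltW // rel // inE eqxx.
- by move=> vx; have := rel x v xpre; rewrite inE eqxx => /(_ isT) /(lt_trans vx); rewrite ltxx.
- by rewrite ltxx.
- by rewrite ltxx.
- by move=> xw; have := wl _ xl => /(lt_trans xw); rewrite ltxx.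
- by move=> _; rewrite ltW // wl.
Qed.

(* [u0] is the point of [p] preceding [v]; the points of [v :: l] are inserted
   into [p] from right to left, so each split has endpoints [leftpt p u] and
   [rightpt p' u]. *)
Lemma adjsum_refine p p' (g : R -> R -> R) (h : R -> R -> R -> R) :
  is_partition p -> is_partition p' -> {subset p <= p'} ->
  (forall a b c, a < b -> b < c -> g a b + g b c = h a b c + g a c) ->
  forall l pre u0 v, p' = pre ++ v :: l -> u0 \in p -> u0 < v ->
  (forall x, x \in p -> x < v -> x <= u0) ->
  adjsum g v l + g u0 v = adjsum g u0 [seq x <- v :: l | x \in p]
    + \sum_(u <- v :: l | u \notin p) h (leftpt p u) u (rightpt p' u).
Proof.
move=> pp pp' sub gh; elim=> [|w l IH] pre u0 v e u0p u0v max0.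
  (* A single remaining point is the last one of [p'], hence 1, hence a point of [p]. *)
  have vp : v \in p.
    have <- : 1 = v by case: pp' => _ _ <- _; rewrite e last_cat.
    exact: mem1_part.
  by rewrite /= vp big_cons vp big_nil /=; ring.
have pw : pairwise <%R p' by rewrite -lt_sorted_pairwise; case: pp'.
have con x : x \in p' -> [/\ v < w, x < w -> x <= v & v < x -> w <= x].
  by rewrite e in pw *; exact: pairwise_consecutive.
have vp' : v \in p' by rewrite e mem_cat mem_head orbT.
have wp' : w \in p' by rewrite e mem_cat !inE eqxx !orbT.
have [vw _ _] := con _ vp'.
have e' : p' = rcons pre v ++ w :: l by rewrite cat_rcons.
(* A point [v] of [p] closes an interval of [p] and replaces [u0]; a new point [v] leaves [u0] in
   place. *)
have [vp|vp] := boolP (v \in p).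
  have mv x : x \in p -> x < w -> x <= v by move=> /sub /con[].
  have IH' := IH (rcons pre v) v w e' vp vw mv.
  have -> : [seq x <- [:: v, w & l] | x \in p] = v :: [seq x <- w :: l | x \in p].
    by rewrite /= vp.
  rewrite [X in _ = _ + X]big_cons [X in _ = _ + X]ifF ?vp // 2!adjsum_cons.
  by rewrite -[RHS]addrA -IH'; ring.
have mu x : x \in p -> x < w -> x <= u0.
  move=> xp xw; apply: max0 => //.
  have [_ /(_ xw) xv _] := con x (sub _ xp).
  by rewrite lt_neqAle xv andbT; apply: contraNneq vp => <-.
have IH' := IH (rcons pre v) u0 w e' u0p (lt_trans u0v vw) mu.
have -> : [seq x <- [:: v, w & l] | x \in p] = [seq x <- w :: l | x \in p].
  by rewrite /= (negPf vp).
rewrite big_cons vp adjsum_cons.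
have u00 := part_itv _ _ pp u0p.
have v0 : 0 < v by lra.
have -> : leftpt p v = u0.
  have [l1 l2 l3] := leftptP _ _ pp v0.
  by apply/le_anti; rewrite l3 // max0.
have -> : rightpt p' v = w.
  have v1 : v < 1 by have := part_itv _ _ pp' wp'; lra.
  have [r1 r2 r3] := rightptP _ _ pp' vp' v1.
  by apply/le_anti; rewrite r3 //=; have [_ _ ->] := con _ r1.
(* The induction hypothesis handles the tail with the unsplit interval from [u0] to [w]; [gh] then
   splits that interval at [v]. *)
transitivity (h u0 v w + (adjsum g w l + g u0 w)).
  have := gh u0 v w u0v vw; lra.
by rewrite IH' addrCA.
Qed.

Lemma filter_part p p' : is_partition p -> is_partition p' -> {subset p <= p'} ->
  [seq x <- p' | x \in p] = p.
Proof.
move=> [sp _ _ _] [sp' _ _ _] sub; apply: lt_sorted_eq => //.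
  by apply: sorted_filter => //; exact: lt_trans.
by move=> x; rewrite mem_filter; case xp: (x \in p) => //=; rewrite sub.
Qed.

(** Used with [g] the function [gramt s t] and [h] a product of two hat values, for which the
    splitting rule is Bessel's identity. *)
Lemma sum_refine p p' (g : R -> R -> R) (h : R -> R -> R -> R) :
  is_partition p -> is_partition p' -> {subset p <= p'} ->
  (forall a b c, a < b -> b < c -> g a b + g b c = h a b c + g a c) ->
  \sum_(i < nint p') g p'`_i p'`_i.+1 = \sum_(i < nint p) g p`_i p`_i.+1
    + \sum_(u <- p' | u \notin p) h (leftpt p u) u (rightpt p' u).
Proof.
move=> pp pp' sub gh.
have [z [v [l e]]] : exists z v l, p' = [:: z, v & l].
  by case: pp'; case: (p') => [|z [|v l]] // *; exists z, v, l.
have z0 : z = 0 by case: pp'; rewrite e.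
have zv : z < v.
  by have := nth_part_lt p' 0 1 pp' (nint_gt0 _ pp') isT; rewrite e.
have [ep] : p = 0 :: [seq x <- v :: l | x \in p].
  by rewrite -{1}(filter_part _ _ pp pp' sub) e z0 [LHS]/= mem0_part.
have -> : \sum_(i < nint p) g p`_i p`_i.+1 = adjsum g 0 [seq x <- v :: l | x \in p].
  by rewrite -adjsumE -ep.
have -> : \sum_(i < nint p') g p'`_i p'`_i.+1 = adjsum g z (v :: l).
  by rewrite e adjsumE.
rewrite z0 [X in _ = _ + \sum_(u <- X | _) _]e [X in _ = _ + X]big_cons [X in _ = _ + X]ifF; last by rewrite z0 mem0_part.
rewrite adjsum_cons.
rewrite addrC.
apply: (adjsum_refine _ _ _ _ pp pp' sub gh l [:: z]); rewrite ?mem0_part -?z0 //.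
move=> x xp xv; have := sub _ xp; rewrite e inE => /orP[/eqP->//|xvl].
have : pairwise <%R p' by rewrite -lt_sorted_pairwise; case: pp'.
rewrite e /= => /and3P[_ /allP vl _]; move: xvl; rewrite inE.
by case/orP => [/eqP xv'|/vl]; [rewrite xv' ltxx in xv|move/(lt_trans xv); rewrite ltxx].
Qed.

(** The inner product of the projections of the indicators of [[0, s]] and [[0, t]] onto the step
    functions of [p]; for [pi M] this is the [G_M] of the overview. *)
Definition gram p s t : R := \sum_(i < nint p) gramt s t p`_i p`_i.+1.

Lemma size_newpts (pi : nat -> seq R) m : is_partition (pi m) ->
  is_partition (pi m.+1) -> {subset pi m <= pi m.+1} ->
  size (newpts pi m) = nlev pi m.
Proof.
move=> pp pp' sub; rewrite /nlev /newpts size_filter.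
have := count_predC (fun u => u \in pi m) (pi m.+1).
rewrite -[X in (X + _)%N]size_filter filter_part //.
rewrite -[X in (_ + X)%N]/(count (fun u => u \notin pi m) (pi m.+1)).
move: (nint_gt0 _ pp) (nint_gt0 _ pp'); rewrite /nint.
by case: (size (pi m)) => [|a]; case: (size (pi m.+1)) => [|b] //= _ _ []; lia.
Qed.

Lemma sum_newpts (pi : nat -> seq R) m (F : R -> R) : is_partition (pi m) ->
  is_partition (pi m.+1) -> {subset pi m <= pi m.+1} ->
  \sum_(k < nlev pi m) F (newpts pi m)`_k = \sum_(u <- pi m.+1 | u \notin pi m) F u.
Proof.
move=> pp pp' sub; rewrite -[RHS]big_filter -/(newpts pi m) -(size_newpts _ _ pp pp' sub).
by rewrite [RHS](big_nth 0) big_mkord.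
Qed.

(** * Schauder functions of a refining sequence *)

Section Refining.
Variable pi : nat -> seq R.
Hypothesis hpart : forall n, is_partition (pi n).
Hypothesis hsub : forall n, {subset pi n <= pi n.+1}.

Lemma newptsP m u : u \in newpts pi m ->
  [/\ 0 <= leftpt (pi m) u, leftpt (pi m) u < u, u < rightpt (pi m.+1) u &
   u \in pi m.+1 /\ u \notin pi m].
Proof.
rewrite mem_filter => /andP[um um1].
have u01 := part_itv _ _ (hpart _) um1.
have u0 : 0 < u.
  rewrite lt0r; case/andP: u01 => -> _; rewrite andbT.
  by apply: contraNneq um => ->; rewrite mem0_part.
have u1 : u < 1.
  rewrite lt_neqAle; case/andP: u01 => _ ->; rewrite andbT.
  by apply: contraNneq um => ->; rewrite mem1_part.
have [l1 l2 _] := leftptP _ _ (hpart m) u0.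
have [r1 r2 _] := rightptP _ _ (hpart m.+1) um1 u1.
by split => //; case/andP: (part_itv _ _ (hpart m) l1).
Qed.

Lemma schauderE m k t : (k < nlev pi m)%N ->
  schauder pi m k t = let u := (newpts pi m)`_k in
    hat (leftpt (pi m) u) u (rightpt (pi m.+1) u) t.
Proof.
move=> km; have um : (newpts pi m)`_k \in newpts pi m.
  by rewrite mem_nth // size_newpts.
have [h0 h1 h2 _] := newptsP _ _ um.
by rewrite /schauder /psi Rintegral_haar // ltW.
Qed.

Lemma sum_schauder_level m s t :
  \sum_(k < nlev pi m) schauder pi m k s * schauder pi m k t =
  gram (pi m.+1) s t - gram (pi m) s t.
Proof.
pose h u := let e := hat (leftpt (pi m) u) u (rightpt (pi m.+1) u) in e s * e t.
rewrite (eq_bigr (fun k => h (newpts pi m)`_(k : 'I_ _))); last first.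
  by move=> k _; rewrite !schauderE.
rewrite sum_newpts // /gram.
rewrite (sum_refine _ _ (gramt s t) (fun a b c => hat a b c s * hat a b c t)
  (hpart m) (hpart m.+1) (hsub m)); first by rewrite addrAC subrr add0r.
by move=> a b c ab bc; exact: gramt_split.
Qed.

Hypothesis h0 : pi 0%N = [:: 0; 1].

Lemma sum_schauder M s t : 0 <= s <= 1 -> 0 <= t <= 1 ->
  \sum_(m < M) \sum_(k < nlev pi m) schauder pi m k s * schauder pi m k t =
  gram (pi M) s t - s * t.
Proof.
move=> s01 t01; under eq_bigr do rewrite sum_schauder_level.
rewrite -(big_mkord xpredT (fun m => gram (pi m.+1) s t - gram (pi m) s t)).
rewrite telescope_sumr //; congr (_ - _).
(* The telescoped sum starts at the partition with points 0 and 1, whose single interval contributes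
   [s * t]. *)
rewrite h0 /gram /nint /= big_ord_recl big_ord0 /= /gramt !ramp_mid //.
by rewrite !subr0 divr1 addr0.
Qed.

Lemma sub_part n m : (n <= m)%N -> {subset pi n <= pi m}.
Proof.
elim: m => [|m IH]; first by rewrite leqn0 => /eqP->.
rewrite leq_eqVlt => /predU1P[->//|]; rewrite ltnS => /IH nm x /nm; exact: hsub.
Qed.

(** The support of a level-[m] hat has no point of [pi m] in its interior. At points of [pi n] the
    series therefore reduces to a finite sum. *)
Lemma schauder_part0 n m k s : (n <= m)%N -> (k < nlev pi m)%N -> s \in pi n ->
  schauder pi m k s = 0.
Proof.
move=> nm km /(sub_part _ _ nm) sm; rewrite schauderE //=.
have um : (newpts pi m)`_k \in newpts pi m by rewrite mem_nth // size_newpts.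
have [l0 l1 l2 [um1 un]] := newptsP _ _ um; set u := _`_k in um l0 l1 l2 um1 un *.
have [su|us|su] := ltgtP s u; last by rewrite -su sm in un.
  have [_ _ lm] := leftptP _ _ (hpart m) (le_lt_trans l0 l1).
  by apply: hat_le; [exact: ltW|exact: ltW|exact: lm].
have u1 : u < 1 by rewrite (lt_le_trans us) //; case/andP: (part_itv _ _ (hpart m) sm).
have [_ _ rm] := rightptP _ _ (hpart m.+1) um1 u1.
by apply: hat_ge => //; rewrite rm // hsub.
Qed.

End Refining.
End Partitions.

(** * Increments over a coarser partition *)

Section Covariance.
Context {R : realType}.
Implicit Types (p q : seq R) (a b u v w s t : R).

Lemma step_le_mesh p i : (i < nint p)%N -> p`_i.+1 - p`_i <= mesh p.
Proof. by move=> ip; rewrite /mesh (le_bigmax _ _ (Ordinal ip)). Qed.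

Lemma mesh_le1 p : is_partition p -> mesh p <= 1.
Proof.
move=> pp; apply: bigmax_le => // i _.
have := part_itv _ _ pp (mem_nth_part _ i.+1 pp (ltn_ord i)).
have := part_itv _ _ pp (mem_nth_part _ i pp (ltnW (ltn_ord i))); lra.
Qed.

Lemma mesh_gt0 p : is_partition p -> 0 < mesh p.
Proof.
move=> pp; apply: lt_le_trans (step_le_mesh p 0 (nint_gt0 _ pp)).
by rewrite subr_gt0 nth_part_lt // nint_gt0.
Qed.

Lemma refine_step p q i : is_partition p -> is_partition q -> {subset p <= q} ->
  (i < nint q)%N -> exists2 j, (j < nint p)%N & p`_j <= q`_i /\ q`_i.+1 <= p`_j.+1.
Proof.
move=> pp pq sub iq.
have qi : q`_i < q`_i.+1 by exact: nth_part_lt.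
have := part_itv _ _ pq (mem_nth_part _ i.+1 pq iq).
have := part_itv _ _ pq (mem_nth_part _ i pq (ltnW iq)) => h1 h2.
(* Locating the midpoint avoids the ambiguity that arises when an end of the interval of [q] is
   itself a point of [p]. *)
have [j jp /andP[l r]] : exists2 j, (j < nint p)%N &
    p`_j <= (q`_i + q`_i.+1) / 2 <= p`_j.+1 by apply: part_locate => //; lra.
exists j => //.
have := part_consecutive _ _ _ pq (sub _ (mem_nth_part _ _ pp (ltnW jp))) iq.
have := part_consecutive _ _ _ pq (sub _ (mem_nth_part _ _ pp jp)) iq.
by move=> [] ? [] ?; split; lra.
Qed.

Lemma mesh_refine p q : is_partition p -> is_partition q -> {subset p <= q} ->
  mesh q <= mesh p.
Proof.
move=> pp pq sub; apply: bigmax_le => [|i _]; first exact/ltW/mesh_gt0.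
have [j jp [h1 h2]] := refine_step _ _ _ pp pq sub (ltn_ord i).
by apply: le_trans (step_le_mesh _ _ jp); lra.
Qed.

Lemma sum_ramp p t : is_partition p -> 0 <= t <= 1 ->
  \sum_(i < nint p) ramp p`_i p`_i.+1 t = t.
Proof.
move=> pp /andP[t0 t1]; rewrite /ramp.
rewrite -(big_mkord xpredT (fun i => Num.min p`_i.+1 t - Num.min p`_i t)).
by rewrite telescope_sumr // nth_part0 // nth_part1 // min_r // min_l // subr0.
Qed.

Lemma sum_ramp_sq p t : is_partition p -> 0 <= t <= 1 ->
  0 <= \sum_(i < nint p) ramp p`_i p`_i.+1 t ^+ 2 <= mesh p.
Proof.
move=> pp t01; rewrite sumr_ge0 => [/=|i _]; last exact: sqr_ge0.
apply: (@le_trans _ _ (\sum_(i < nint p) mesh p * ramp p`_i p`_i.+1 t)).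
  apply: ler_sum => i _.
  have pi : p`_i <= p`_i.+1 by rewrite ltW // nth_part_lt.
  have /andP[r0 r1] := ramp_itv _ _ t pi.
  by rewrite expr2 ler_wpM2r // (le_trans r1) // step_le_mesh.
by rewrite -mulr_sumr sum_ramp // ler_piMr ?(ltW (mesh_gt0 _ pp)); lra.
Qed.

(** Intervals before [t] contribute their full length and later ones nothing; only the interval
    containing [t] leaves a defect, at most its length. *)
Lemma gram_diag p t : is_partition p -> 0 <= t <= 1 ->
  t - mesh p <= gram p t t <= t.
Proof.
move=> pp t01; have [i ip ti] := part_locate _ _ pp t01.
have f0 (j : 'I_(nint p)) : p`_j < p`_j.+1 by rewrite nth_part_lt.
suff : 0 <= \sum_(j < nint p) (ramp p`_j p`_j.+1 t - gramt t t p`_j p`_j.+1) <= mesh p.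
  by rewrite sumrB sum_ramp // -/(gram p t t); lra.
have tE (j : 'I_(nint p)) : ramp p`_j p`_j.+1 t - gramt t t p`_j p`_j.+1 =
  ramp p`_j p`_j.+1 t * ((p`_j.+1 - p`_j - ramp p`_j p`_j.+1 t) / (p`_j.+1 - p`_j)).
  by have := f0 j => ?; rewrite /gramt; field; lra.
under eq_bigr do rewrite tE.
rewrite sumr_ge0 /= => [|j _]; last first.
  have := ramp_itv _ _ t (ltW (f0 j)) => /andP[a0 a1].
  by rewrite mulr_ge0 // divr_ge0 // subr_ge0 // ltW.
rewrite (bigD1 (Ordinal ip)) //= big1 ?addr0 => [|j ji].
  have := ramp_itv _ _ t (ltW (f0 (Ordinal ip))) => /= /andP[a0 a1].
  have d0 : 0 < p`_i.+1 - p`_i by rewrite subr_gt0 (f0 (Ordinal ip)).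
  rewrite (le_trans _ (step_le_mesh _ _ ip)) // (le_trans _ a1) //.
  by rewrite ler_piMr // ler_pdivrMr // mul1r lerBlDr lerDl.
have := f0 j => fj.
have [ij|] := ltnP i j.
  rewrite ramp_le ?mul0r // ?(ltW fj) //.
  have pij : p`_i.+1 <= p`_j by rewrite nth_part_le // ltnW.
  by case/andP: ti => _ ti; rewrite (le_trans ti).
rewrite -val_eqE /= in ji; rewrite leq_eqVlt (negPf ji) /= => ij.
have : p`_j.+1 <= p`_i by rewrite nth_part_le // ltnW.
move=> h; case/andP: ti => ti _.
by rewrite ramp_ge ?(le_trans h) // ?subrr ?mul0r ?mulr0 // (ltW fj).
Qed.

(* Covariance of the increments over the intervals of [p], stopped at [t], of
   the process with covariance function [gram q u v - u * v]. *)
Definition stopped_cov p q t (i i' : nat) : R :=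
  let s j := Num.min p`_j t in
  gram q (s i.+1) (s i'.+1) - gram q (s i.+1) (s i') - gram q (s i) (s i'.+1)
   + gram q (s i) (s i') - (s i.+1 - s i) * (s i'.+1 - s i').

(** * Diagonal plus rank one structure of the covariance *)

Section Fixed.
Variables (p q : seq R) (t : R).
Hypotheses (pp : is_partition p) (pq : is_partition q) (sub : {subset p <= q}).
Hypothesis t01 : 0 <= t <= 1.

Let s i := Num.min p`_i t.
Let dl (i : 'I_(nint p)) := s i.+1 - s i.
(** [G i I] is the length of the overlap of the stopped interval [i] of [p] with the interval [I] of
    [q]. [B] is the covariance of the projected Brownian increments; the full covariance subtracts
    the rank one matrix built from [dl]. *)
Let G (i : 'I_(nint p)) (I : 'I_(nint q)) :=
  ramp q`_I q`_I.+1 (s i.+1) - ramp q`_I q`_I.+1 (s i).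
Let B i i' := \sum_(I < nint q) G i I * G i' I / (q`_I.+1 - q`_I).

Let qlt (I : 'I_(nint q)) : q`_I < q`_I.+1.
Proof. by rewrite nth_part_lt. Qed.

Let plt (i : 'I_(nint p)) : p`_i < p`_i.+1.
Proof. by rewrite nth_part_lt. Qed.

Let sle (i : 'I_(nint p)) : s i <= s i.+1.
Proof. by rewrite /s le_min2 // ltW. Qed.

Lemma stopped_itv i : (i <= nint p)%N -> 0 <= Num.min p`_i t <= 1.
Proof.
move=> ip; have := part_itv _ _ pp (mem_nth_part _ i pp ip).
by case: (leP p`_i t); move: t01; lra.
Qed.

Let covE (i i' : 'I_(nint p)) : stopped_cov p q t i i' = B i i' - dl i * dl i'.
Proof.
rewrite /stopped_cov; congr (_ - _); rewrite /gram -!sumrB -big_split /=.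
by apply: eq_bigr => I _; rewrite /gramt /G; ring.
Qed.

Let G_itv i I : 0 <= G i I <= q`_I.+1 - q`_I.
Proof.
have h := ltW (qlt I); rewrite /G.
have := ramp_homo _ _ _ _ h (sle i).
have := ramp_itv _ _ (s i) h; have := ramp_itv _ _ (s i.+1) h; lra.
Qed.

Let sum_G i : \sum_I G i I = dl i.
Proof. by rewrite sumrB !sum_ramp // stopped_itv // ltnW. Qed.

(** The right end of interval [i] belongs to [q], so it does not cut interval [I]. If it lies to the
    left, increment [i] misses [I]; otherwise increment [i'] misses [I] or is already stopped at
    [t]. *)
Let G_lt (i i' : 'I_(nint p)) I : (i < i')%N -> G i I * G i' I = 0.
Proof.
move=> ii'; have h := ltW (qlt I).
have pi : p`_i.+1 \in q by rewrite sub // mem_nth_part.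
have sp k : s k <= p`_k by rewrite /s ge_min lexx.
have [u1|u1] := part_consecutive _ _ _ pq pi (ltn_ord I).
  rewrite /G ramp_le ?(le_trans (sp _)) // ramp_le ?subrr ?mul0r //.
  by rewrite (le_trans (sle i)) // (le_trans (sp _)).
have pii : p`_i.+1 <= p`_i' by rewrite nth_part_le // ltnW.
have [tq|qt] := leP q`_I.+1 t.
  have qs k : q`_I.+1 <= p`_k -> q`_I.+1 <= s k by move=> ?; rewrite /s le_min; lra.
  rewrite /G (ramp_ge _ _ (s i'.+1)) // ?(ramp_ge _ _ (s i')) // ?subrr ?mulr0 //.
    by rewrite qs // (le_trans u1).
  by rewrite (le_trans _ (sle i')) // qs // (le_trans u1).
have se (k : nat) : q`_I.+1 <= p`_k -> s k = t by rewrite /s => ?; rewrite min_r //; lra.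
have e1 : s i' = t by rewrite se // (le_trans u1).
have e2 : s i'.+1 = t by rewrite se // (le_trans u1) // (le_trans pii) // ltW.
by rewrite /G e1 e2 subrr mulr0.
Qed.

Let G_neq i i' I : i != i' -> G i I * G i' I = 0.
Proof.
rewrite -val_eqE neq_ltn => /orP[]; first exact: G_lt.
by rewrite mulrC; exact: G_lt.
Qed.

Let B_neq i i' : i != i' -> B i i' = 0.
Proof. by move=> ii'; rewrite /B big1 // => I _; rewrite G_neq // mul0r. Qed.

Let B_itv i : 0 <= B i i <= dl i.
Proof.
rewrite sumr_ge0 /= => [|I _]; last first.
  have := G_itv i I => /andP[? ?].
  by rewrite divr_ge0 ?mulr_ge0 // subr_ge0 ltW.
rewrite -sum_G; apply: ler_sum => I _; have /andP[g0 g1] := G_itv i I.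
have := qlt I; rewrite -subr_gt0 => ql.
by rewrite ler_pdivrMr // ler_wpM2l.
Qed.

(** For each [I] the cross products vanish, so the sum of the squares of [G i I] over [i] is the
    square of their sum, which is a ramp at [t]. *)
Let sum_B : \sum_i B i i = gram q t t.
Proof.
rewrite exchange_big; apply: eq_bigr => I _; rewrite /gramt -mulr_suml.
congr (_ / _).
have -> : ramp q`_I q`_I.+1 t = \sum_i G i I.
  rewrite /G -(big_mkord xpredT
   (fun i => ramp q`_I q`_I.+1 (s i.+1) - ramp q`_I q`_I.+1 (s i))).
  rewrite telescope_sumr // /s nth_part0 // nth_part1 //.
  case/andP: t01 => t0 t1; rewrite (min_r t1) (min_l t0).
  rewrite (ramp_le _ _ 0 (ltW (qlt I))) ?subr0 //.
  by case/andP: (part_itv _ _ pq (mem_nth_part _ I pq (ltnW (ltn_ord I)))).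
rewrite mulr_suml; apply: eq_bigr => i _; rewrite mulr_sumr (bigD1 i) //=.
by rewrite big1 ?addr0 // => j ji; rewrite G_neq // eq_sym.
Qed.

Let sum_dl2 : 0 <= \sum_i dl i ^+ 2 <= mesh p.
Proof. exact: sum_ramp_sq. Qed.

Let dl_itv i : 0 <= dl i <= 1.
Proof.
have := sle i; have := stopped_itv _ (ltn_ord i).
have := stopped_itv _ (ltnW (ltn_ord i)); rewrite /dl /s; lra.
Qed.

(** The trace is [gram q t t] minus the sum of the squared time increments; each of the two terms
    causes an error of at most [mesh p]. *)
Lemma stopped_cov_trace : `|\sum_(i < nint p) stopped_cov p q t i i - t| <= 2 * mesh p.
Proof.
under eq_bigr do rewrite covE -expr2.
rewrite sumrB sum_B; have := gram_diag _ _ pq t01.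
have := mesh_refine _ _ pp pq sub; move: sum_dl2 => /=.
set x := \sum_(i < _) _; rewrite ler_norml; lra.
Qed.

(** The inequality [(b - d)^2 <= 2 b^2 + 2 d^2] separates the diagonal part from the rank one part.
    Both have squared norm at most [mesh p], the second because [mesh p <= 1]. *)
Lemma stopped_cov_sq :
  \sum_(i < nint p) \sum_(i' < nint p) stopped_cov p q t i i' ^+ 2 <= 4 * mesh p.
Proof.
have h1 : \sum_(i < nint p) \sum_(i' < nint p) stopped_cov p q t i i' ^+ 2 <=
   \sum_i \sum_i' (2 * B i i' ^+ 2 + 2 * (dl i ^+ 2 * dl i' ^+ 2)).
  apply: ler_sum => i _; apply: ler_sum => i' _; rewrite covE.
  have := sqr_ge0 (B i i' + dl i * dl i'); nra.
apply: (le_trans h1).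
have -> : \sum_i \sum_i' (2 * B i i' ^+ 2 + 2 * (dl i ^+ 2 * dl i' ^+ 2)) =
  2 * (\sum_i B i i ^+ 2) + 2 * (\sum_i dl i ^+ 2) ^+ 2.
  under eq_bigr do rewrite big_split /=.
  rewrite big_split /=; congr (_ + _).
    rewrite mulr_sumr; apply: eq_bigr => i _; rewrite (bigD1 i) //= big1 ?addr0 //.
    by move=> j ji; rewrite B_neq ?expr0n ?mulr0 // eq_sym.
  rewrite expr2 mulr_suml mulr_sumr; apply: eq_bigr => i _.
  by rewrite !mulr_sumr.
have h2 : \sum_i B i i ^+ 2 <= \sum_i dl i ^+ 2.
  by apply: ler_sum => i _; have := B_itv i; nra.
have := mesh_le1 _ pp; have := sum_dl2; have := h2.
by set x := \sum_(i < _) _; set y := \sum_(i < _) _ => ? /andP[? ?] ?; nra.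
Qed.

(** This is the variance of the cross term between drift and stochastic increments. The rank one
    part enters as minus a square and is dropped. *)
Lemma stopped_cov_lin : \sum_(i < nint p) \sum_(i' < nint p)
  ramp p`_i p`_i.+1 t * ramp p`_i' p`_i'.+1 t * stopped_cov p q t i i' <= mesh p.
Proof.
have -> : \sum_(i < nint p) \sum_(i' < nint p) ramp p`_i p`_i.+1 t *
    ramp p`_i' p`_i'.+1 t * stopped_cov p q t i i' =
    \sum_i (dl i ^+ 2 * B i i) - (\sum_i dl i ^+ 2) ^+ 2.
  have -> : (\sum_i dl i ^+ 2) ^+ 2 = \sum_i \sum_i' dl i ^+ 2 * dl i' ^+ 2.
    by rewrite expr2 mulr_suml; apply: eq_bigr => i _; rewrite mulr_sumr.
  rewrite -sumrB; apply: eq_bigr => i _.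
  have -> : dl i ^+ 2 * B i i = \sum_i' dl i * dl i' * B i i'.
    rewrite (bigD1 i) //= big1 ?addr0 // => j ji.
    by rewrite B_neq ?mulr0 // eq_sym.
  by rewrite -sumrB; apply: eq_bigr => i' _; rewrite covE -[LHS]/(dl i * dl i' * _); ring.
have h2 : \sum_i (dl i ^+ 2 * B i i) <= \sum_i dl i ^+ 2.
  apply: ler_sum => i _; have := B_itv i; have := dl_itv i => /andP[d0 d1] /andP[b0 b1].
  by rewrite ler_piMr ?sqr_ge0 // (le_trans b1).
by have := sum_dl2; have := sqr_ge0 (\sum_i dl i ^+ 2); lra.
Qed.

End Fixed.
End Covariance.

(** * Deterministic estimates for paths *)

Section PathBounds.
Context {R : realType}.
Implicit Types (p q : seq R) (s t : R).

Lemma cvg_exN (u : nat -> R) (l e : R) : u n @[n --> \oo] --> l -> 0 < e ->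
  exists N, forall n, (N <= n)%N -> `|u n - l| < e.
Proof.
move=> /cvgrPdist_lt /[apply] -[N _ H]; exists N => n Nn.
by rewrite distrC; exact: H.
Qed.

Lemma exN_forall_lt (K : nat) (Q : nat -> nat -> Prop) :
  (forall i, (i < K)%N -> exists N, forall n, (N <= n)%N -> Q i n) ->
  exists N, forall n, (N <= n)%N -> forall i, (i < K)%N -> Q i n.
Proof.
elim: K => [|K IH] H; first by exists 0%N.
have [|N1 H1] := IH; first by move=> i iK; exact/H/ltnW.
have [N2 H2] := H K (ltnSn K); exists (maxn N1 N2) => n.
rewrite geq_max => /andP[n1 n2] i; rewrite ltnS leq_eqVlt => /predU1P[->|iK].
  exact: H2.
exact: H1.
Qed.

(** Since [s] is a point of [p], at time [s] each interval is either complete, with a square that no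
    longer changes, or contributes 0. *)
Lemma dqv_mono p (x : R -> R) s t : is_partition p -> s \in p -> s <= t ->
  dqv p x s <= dqv p x t.
Proof.
move=> pp sp st; apply: ler_sum => i _.
have pi : p`_i < p`_i.+1 by rewrite nth_part_lt.
have [sl|sr] := part_consecutive _ _ _ pp sp (ltn_ord i).
  rewrite !(min_r _ : Num.min _ s = s) ?subrr ?expr0n ?sqr_ge0 //.
  by rewrite (le_trans sl) // ltW.
have h := le_trans (ltW pi) sr.
by rewrite !min_l // (le_trans _ st).
Qed.

(** Only the interval containing [t] can have a larger square at [t] than at [s], and its increment
    at [t] is an oscillation of [x] on the scale of the mesh. *)
Lemma dqv_osc p (x : R -> R) s t (w : R) : is_partition p -> 0 <= t <= 1 -> t <= s ->
  (forall u v, 0 <= u <= 1 -> 0 <= v <= 1 -> `|u - v| <= mesh p -> `|x u - x v| <= w) ->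
  dqv p x t <= dqv p x s + w ^+ 2.
Proof.
move=> pp t01 ts osc; have [i ip /andP[it ti]] := part_locate _ _ pp t01.
rewrite /dqv (bigD1 (Ordinal ip)) //= [X in _ <= X + _](bigD1 (Ordinal ip)) //=.
have A : (x (Num.min p`_i.+1 t) - x (Num.min p`_i t)) ^+ 2 <= w ^+ 2.
  rewrite (min_r ti) (min_l it) -real_normK ?num_real //.
  have i01 := part_itv _ _ pp (mem_nth_part _ i pp (ltnW ip)).
  have d : `|t - p`_i| <= mesh p.
    rewrite ger0_norm ?subr_ge0 //; apply: le_trans (step_le_mesh _ _ ip).
    by rewrite lerD2r.
  have := osc _ _ t01 i01 d => h.
  by rewrite lerXn2r // nnegrE (le_trans _ h).
have B : \sum_(j < nint p | j != Ordinal ip)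
    (x (Num.min p`_j.+1 t) - x (Num.min p`_j t)) ^+ 2 <=
  \sum_(j < nint p | j != Ordinal ip)
    (x (Num.min p`_j.+1 s) - x (Num.min p`_j s)) ^+ 2.
  apply: ler_sum => j; rewrite -val_eqE /= neq_ltn => /orP[ji|ij].
    have h : p`_j.+1 <= t by rewrite (le_trans _ it) // nth_part_le // ltnW.
    have h' : p`_j <= t by rewrite (le_trans _ h) // ltW // nth_part_lt.
    by rewrite !min_l // (le_trans _ ts).
  have h : t <= p`_j by rewrite (le_trans ti) // nth_part_le // ltnW.
  have h' : t <= p`_j.+1 by rewrite (le_trans h) // ltW // nth_part_lt.
  by rewrite (min_r h) (min_r h') subrr expr0n sqr_ge0.
have := sqr_ge0 (x (Num.min p`_i.+1 s) - x (Num.min p`_i s)); lra.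
Qed.

(* Polya's argument: up to the oscillation of [x], the discrete quadratic
   variation is nondecreasing in time, and the limit is continuous. *)
Lemma dqv_uniform (pi : nat -> seq R) (x : R -> R) :
  (forall n, is_partition (pi n)) -> (forall n, {subset pi n <= pi n.+1}) ->
  mesh (pi n) @[n --> \oo] --> 0 ->
  (forall e, 0 < e -> exists2 d, 0 < d & forall u v, 0 <= u <= 1 -> 0 <= v <= 1 ->
     `|u - v| < d -> `|x u - x v| < e) ->
  (forall m i, (i <= nint (pi m))%N ->
     dqv (pi n) x (pi m)`_i @[n --> \oo] --> (pi m)`_i) ->
  forall e : R, 0 < e -> exists N : nat, forall n, (N <= n)%N ->
    forall t, 0 <= t <= 1 -> `|dqv (pi n) x t - t| < e.
Proof.
move=> hp hs hm ux cx e e0; have e4 : 0 < e / 4 by lra.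
have [m /(_ m (leqnn _))] := cvg_exN _ _ _ hm e4.
rewrite subr0 ger0_norm ?(ltW (mesh_gt0 _ (hp m))) // => mm.
have [N1 H1] : exists N, forall n, (N <= n)%N -> forall i, (i < (nint (pi m)).+1)%N ->
    `|dqv (pi n) x (pi m)`_i - (pi m)`_i| < e / 4.
  by apply: exN_forall_lt => i im; apply: cvg_exN => //; exact: cx.
(* With [w <= 1], the bound [w <= e / 4] passes to [w ^+ 2]. *)
have [w [w0 w1 we]] : exists w : R, [/\ 0 < w, w <= 1 & w <= e / 4].
  exists (Num.min 1 (e / 4)); rewrite lt_min ltr01 e4; split => //.
    by rewrite ge_min lexx.
  by rewrite ge_min lexx orbT.
have [dl dl0 H2] := ux _ w0.
have [N3 H3] := cvg_exN _ _ _ hm dl0.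
exists (maxn m (maxn N1 N3)) => n; rewrite !geq_max => /and3P[mn n1 n3] t t01.
have mesh_n : mesh (pi n) < dl.
  by have := H3 _ n3; rewrite subr0 ger0_norm // ltW // mesh_gt0.
have [i im /andP[it ti]] := part_locate _ _ (hp m) t01.
have sub := sub_part _ hs _ _ mn.
(* The value at [t] is squeezed between the values at two neighbouring points of the fixed partition
   [pi m], less than [e / 4] apart. *)
have lo : dqv (pi n) x (pi m)`_i <= dqv (pi n) x t.
  by apply: dqv_mono => //; rewrite sub // mem_nth_part // ltnW.
have hi : dqv (pi n) x t <= dqv (pi n) x (pi m)`_i.+1 + w ^+ 2.
  apply: dqv_osc => // u v u01 v01 uv; rewrite ltW // H2 //.
  exact: le_lt_trans mesh_n.
have ww : w ^+ 2 <= e / 4 by rewrite (le_trans _ we) // expr2 ler_piMl // ltW.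
have := H1 _ n1 i (ltnW im); have := H1 _ n1 i.+1 im.
have := step_le_mesh _ _ im.
rewrite !ltr_norml => ? /andP[? ?] /andP[? ?]; lra.
Qed.

(** Only hats peaking in the interval of [pi m] that contains [t] can be nonzero at [t]. There are
    at most [K] of them, each of height at most the square root of a step of [pi m.+1]. *)
Lemma sum_schauder_bound (pi : nat -> seq R) m (K : nat) (c : nat -> R) (b t : R) :
  (forall n, is_partition (pi n)) -> (forall n, {subset pi n <= pi n.+1}) ->
  (forall i, (i < nint (pi m))%N ->
    leq (count (fun s => ((pi m)`_i <= s) && (s <= (pi m)`_i.+1)) (pi m.+1)) K) ->
  (forall k, (k < nlev pi m)%N -> `|c k| * Num.sqrt (mesh (pi m.+1)) <= b) ->
  0 <= b -> 0 <= t <= 1 ->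
  `|\sum_(k < nlev pi m) c k * schauder pi m k t| <= K%:R * b.
Proof.
move=> hp hs hK hc b0 t01; have [i im /andP[it ti]] := part_locate _ _ (hp m) t01.
pose Q s := ((pi m)`_i <= s) && (s <= (pi m)`_i.+1).
apply: (@le_trans _ _ (\sum_(k < nlev pi m) (if Q (newpts pi m)`_k then b else 0))).
  apply: (le_trans (ler_norm_sum _ _ _)); apply: ler_sum => k _.
  have um : (newpts pi m)`_k \in newpts pi m by rewrite mem_nth // size_newpts.
  rewrite schauderE //=; set u := _`_k in um *.
  have [l0 l1 l2 [um1 un]] := newptsP _ hp _ _ um.
  have u1 : u < 1.
    rewrite (lt_le_trans l2) // -(nth_part1 _ (hp m.+1)) nth_part_le //.
    have [i1 e] := part_index _ _ (hp m.+1) um1.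
    rewrite ltn_neqAle i1 andbT; apply: contraNneq un => e'.
    by rewrite -e e' nth_part1 // mem1_part.
  have u0 := le_lt_trans l0 l1.
  have [r1 r2 r3] := rightptP _ _ (hp m.+1) um1 u1.
  have [q1 q2 q3] := leftptP _ _ (hp m) u0.
  have qi := mem_nth_part _ _ (hp m) (ltnW im); have qi1 := mem_nth_part _ _ (hp m) im.
  case: ifPn => [_|].
    rewrite normrM (le_trans _ (hc k (ltn_ord k))) // ler_wpM2l //.
    rewrite (le_trans (hat_bound _ _ _ _ l1 l2)) // ler_wsqrtr //.
    have [i1 e] := part_index _ _ (hp m.+1) um1.
    rewrite /rightpt -{2}e step_le_mesh // ltn_neqAle i1 andbT.
    by apply/eqP => i1'; move: u1; rewrite -e i1' nth_part1 ?ltxx.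
  rewrite /Q negb_and -!ltNge => /orP[uq|uq].
    by rewrite hat_ge ?mulr0 ?normr0 // (le_trans _ it) // r3 // hs.
  by rewrite hat_le ?mulr0 ?normr0 //; [exact: ltW|exact: ltW|rewrite (le_trans ti) // q3].
rewrite (sum_newpts _ _ (fun u => if Q u then b else 0)) // -big_mkcondr /=.
apply: (@le_trans _ _ (\sum_(u <- pi m.+1 | Q u) b)).
  rewrite [leLHS]big_mkcond [leRHS]big_mkcond; apply: ler_sum => u _.
  by case: (Q u); rewrite ?andbF //; case: ifP.
rewrite big_const_seq iter_addr_0 -[leLHS]mulr_natl ler_wpM2r // ler_nat; exact: hK.
Qed.

Definition lipschitz (f : R -> R) := exists2 L, 0 <= L &
  forall u v, `|f u - f v| <= L * `|u - v|.

Lemma lipschitzD f g : lipschitz f -> lipschitz g -> lipschitz (fun u => f u + g u).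
Proof.
move=> [L L0 Lf] [M M0 Mg]; exists (L + M); first exact: addr_ge0.
move=> u v; rewrite opprD addrACA (le_trans (ler_normD _ _)) // mulrDl.
by rewrite lerD.
Qed.

Lemma lipschitzZ c f : lipschitz f -> lipschitz (fun u => c * f u).
Proof.
move=> [L L0 Lf]; exists (`|c| * L); first by rewrite mulr_ge0.
by move=> u v; rewrite -mulrBr normrM -mulrA ler_wpM2l.
Qed.

Lemma lipschitz_cst c : lipschitz (fun=> c).
Proof. by exists 0 => // u v; rewrite subrr normr0 mul0r. Qed.

Lemma lipschitz_id : lipschitz (fun u => u).
Proof. by exists 1 => // u v; rewrite mul1r. Qed.

Lemma lipschitz_sum n (f : nat -> R -> R) :
  (forall i, (i < n)%N -> lipschitz (f i)) -> lipschitz (fun u => \sum_(i < n) f i u).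
Proof.
elim: n => [|n IH] H.
  by under eq_fun do rewrite big_ord0; exact: lipschitz_cst.
under eq_fun do rewrite big_ord_recr /=.
by apply: lipschitzD; [apply: IH => i /ltnW; exact: H|exact: H].
Qed.

Lemma lipschitz_min a : lipschitz (fun u : R => Num.min a u).
Proof.
exists 1 => // u v; rewrite mul1r.
case: (leP a u) => au; case: (leP a v) => av; rewrite ?subrr ?normr0 //.
- rewrite [leLHS]ger0_norm; last lra.
  by rewrite ger0_norm; lra.
- rewrite [leLHS]ler0_norm; last lra.
  by rewrite ler0_norm; lra.
Qed.

Lemma lipschitz_schauder (pi : nat -> seq R) m k :
  (forall n, is_partition (pi n)) -> (forall n, {subset pi n <= pi n.+1}) ->
  (k < nlev pi m)%N -> lipschitz (schauder pi m k).
Proof.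
move=> hp hs km.
under [schauder pi m k]funext do rewrite schauderE //= /hat -mulNr.
have lr a b : lipschitz (ramp a b).
  rewrite /ramp; under [fun _ => _]funext do rewrite -[X in _ - X]mul1r -mulNr.
  by apply: lipschitzD; [|apply: lipschitzZ]; exact: lipschitz_min.
by apply: lipschitzD; apply: lipschitzZ.
Qed.

End PathBounds.

(** * Variance of quadratic forms *)

Section Moments.
Context {R : realType} {d : measure_display} {Omega : measurableType d}.
Variable P : probability Omega R.
Implicit Types f g : Omega -> R.

Local Notation intg f := (P.-integrable setT (EFin \o f)).
Local Notation Er f := (\int[P]_w f w).

Lemma intgD f g : intg f -> intg g -> intg (fun w => f w + g w).
Proof. by move=> If Ig; exact: (integrableD measurableT If Ig). Qed.

Lemma intgZ c f : intg f -> intg (fun w => c * f w).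
Proof. by move=> If; exact: (integrableZl measurableT c If). Qed.

Lemma intg_cst c : intg (fun=> c).
Proof. exact: finite_measure_integrable_cst. Qed.

Lemma intg_sum I (r : seq I) (F : I -> Omega -> R) :
  (forall i, intg (F i)) -> intg (fun w => \sum_(i <- r) F i w).
Proof.
move=> IF; elim: r => [|i r IH].
  by under [fun _ => _]funext do rewrite big_nil; exact: intg_cst.
by under [fun _ => _]funext do rewrite big_cons; exact: intgD.
Qed.

Lemma Er_sum I (r : seq I) (F : I -> Omega -> R) :
  (forall i, intg (F i)) -> Er (fun w => \sum_(i <- r) F i w) = \sum_(i <- r) Er (F i).
Proof.
move=> IF; elim: r => [|i r IH].
  by rewrite big_nil; under eq_Rintegral do rewrite big_nil; rewrite Rintegral_cst // mul0r.
rewrite big_cons -IH; under eq_Rintegral do rewrite big_cons.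
by rewrite RintegralD //; exact: intg_sum.
Qed.

Lemma intg_dom f g : measurable_fun setT f -> (forall w, `|f w| <= g w) -> intg g -> intg f.
Proof.
move=> mf fg; apply: le_integrable => //; first exact/measurable_EFinP.
by move=> w _ /=; rewrite lee_fin (le_trans (fg w)) // ler_norm.
Qed.

Lemma EFin_Er f : intg f -> (\int[P]_w (f w)%:E)%E = (Er f)%:E.
Proof. by move=> If; rewrite fineK // integrable_fin_num. Qed.

Lemma Er_sum_sq (I : finType) (c : I -> R) (Z : I -> Omega -> R) :
  (forall i j, intg (fun w => Z i w * Z j w)) ->
  (\int[P]_w ((\sum_i c i * Z i w) ^+ 2)%:E)%E =
  (\sum_i \sum_j c i * c j * Er (fun w => Z i w * Z j w))%:E.
Proof.
move=> IZ.
have I2 i j : intg (fun w => c i * c j * (Z i w * Z j w)) by exact: intgZ.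
have I1 i : intg (fun w => \sum_j c i * c j * (Z i w * Z j w)) by exact: intg_sum.
have E w : (\sum_i c i * Z i w) ^+ 2 = \sum_i \sum_j c i * c j * (Z i w * Z j w).
  rewrite expr2 mulr_suml; apply: eq_bigr => i _; rewrite mulr_sumr.
  by apply: eq_bigr => j _; ring.
under eq_integral do rewrite E.
rewrite EFin_Er; last exact: intg_sum.
rewrite Er_sum //; congr EFin; apply: eq_bigr => i _; rewrite Er_sum //.
by apply: eq_bigr => j _; rewrite RintegralZl.
Qed.

Section QuadraticForm.
Variables (T : finType) (eta : T -> Omega -> R) (C : R).
Hypothesis meta : forall j, measurable_fun setT (eta j).
Hypothesis E4 : forall j, (\int[P]_w ((eta j w ^+ 4)%:E) <= C%:E)%E.
Hypothesis E2 : forall i j, (\int[P]_w ((eta i w * eta j w)%:E) = (i == j)%:R%:E)%E.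
(** Unless the two pairs agree up to order, mixed moments are those of independent standardised
    variables; for the remaining pairs only the bound [C] is available. *)
Hypothesis E22 : forall a b c e, (c, e) != (a, b) -> (c, e) != (b, a) ->
  (\int[P]_w ((eta a w * eta b w * (eta c w * eta e w))%:E)
    = ((a == b) && (c == e))%:R%:E)%E.

Lemma intg_pow4 j : intg (fun w => eta j w ^+ 4).
Proof.
apply/integrableP; split.
  by apply/measurable_EFinP; exact: measurable_funX.
rewrite (le_lt_trans _ (ltry C)) // (le_trans _ (E4 j)) //.
apply: ge0_le_integral => //.
- by apply/measurable_EFinP/measurableT_comp => //; exact: measurable_funX.
- by apply/measurable_EFinP; exact: measurable_funX.
- by move=> w _ /=; rewrite lee_fin ger0_norm // exprn_even_ge0.
Qed.

Let q4 j w : 0 <= eta j w ^+ 4.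
Proof. by rewrite exprn_even_ge0. Qed.

Lemma intg_mul2 i j : intg (fun w => eta i w * eta j w).
Proof.
apply: (@intg_dom _ (fun w => 1 + (eta i w ^+ 4 + eta j w ^+ 4))).
- exact: measurable_funM.
- move=> w; have := sqr_ge0 (eta i w ^+ 2 - 1); have := sqr_ge0 (eta j w ^+ 2 - 1).
  have := sqr_ge0 (eta i w - eta j w); have := sqr_ge0 (eta i w + eta j w).
  rewrite (_ : eta i w ^+ 4 = (eta i w ^+ 2) ^+ 2); last by rewrite -exprM.
  rewrite (_ : eta j w ^+ 4 = (eta j w ^+ 2) ^+ 2); last by rewrite -exprM.
  by rewrite ler_norml => h1 h2 h3 h4; apply/andP; split; nra.
- apply: intgD; first exact: intg_cst.
  by apply: intgD; exact: intg_pow4.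
Qed.

Let abs4 (x y z u : R) : `|x * y * (z * u)| <= 4^-1 * (x ^+ 4 + y ^+ 4 + (z ^+ 4 + u ^+ 4)).
Proof.
have H (a b : R) : 2 * `|a * b| <= a ^+ 2 + b ^+ 2.
  rewrite normrM -(real_normK (num_real a)) -(real_normK (num_real b)).
  by have := sqr_ge0 (`|a| - `|b|); nra.
have H2 (a b : R) : 2 * (a ^+ 2 * b ^+ 2) <= a ^+ 4 + b ^+ 4.
  by have := sqr_ge0 (a ^+ 2 - b ^+ 2); lra.
by have := H (x * y) (z * u); have := H2 x y; have := H2 z u; rewrite !exprMn; lra.
Qed.

Lemma intg_mul4 a b c e : intg (fun w => eta a w * eta b w * (eta c w * eta e w)).
Proof.
apply: (@intg_dom _ (fun w => 4^-1 * (eta a w ^+ 4 + eta b w ^+ 4 + (eta c w ^+ 4 + eta e w ^+ 4)))).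
- by apply: measurable_funM; apply: measurable_funM.
- by move=> w; exact: abs4.
- by apply: intgZ; apply: intgD; apply: intgD; exact: intg_pow4.
Qed.

(** By the arithmetic-geometric mean inequality the integrand is dominated by the average of four
    fourth powers. *)
Lemma Er_mul4_le a b c e : `|Er (fun w => eta a w * eta b w * (eta c w * eta e w))| <= C.
Proof.
apply: (le_trans (le_normr_Rintegral _ (intg_mul4 a b c e))) => //.
have I4 := intg_pow4.
apply: (@le_trans _ _ (Er (fun w => 4^-1 * (eta a w ^+ 4 + eta b w ^+ 4 + (eta c w ^+ 4 + eta e w ^+ 4))))).
  apply: le_Rintegral => //.
  - by have := integrable_abse (intg_mul4 a b c e).
  - by apply: intgZ; apply: intgD; exact: intgD.
have L j : Er (fun w => eta j w ^+ 4) <= C by rewrite -lee_fin -EFin_Er.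
rewrite RintegralZl //; last by apply: intgD; exact: intgD.
rewrite RintegralD //; [|exact: intgD|exact: intgD].
by rewrite !RintegralD //; have := (L a, L b, (L c, L e)) => -[[] ? ? []]; lra.
Qed.

Let zeta (X : T * T) w := eta X.1 w * eta X.2 w - (X.1 == X.2)%:R.

Let intg_zeta X Y : intg (fun w => zeta X w * zeta Y w).
Proof.
have E w : zeta X w * zeta Y w = eta X.1 w * eta X.2 w * (eta Y.1 w * eta Y.2 w)
   + ((- (Y.1 == Y.2)%:R) * (eta X.1 w * eta X.2 w) +
   ((- (X.1 == X.2)%:R) * (eta Y.1 w * eta Y.2 w) + (X.1 == X.2)%:R * (Y.1 == Y.2)%:R)).
  by rewrite /zeta; ring.
under [fun _ => _]funext do rewrite E.
apply: intgD; first exact: intg_mul4.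
apply: intgD; first exact/intgZ/intg_mul2.
by apply: intgD; [exact/intgZ/intg_mul2|exact: intg_cst].
Qed.

Let Er_zeta X Y : Er (fun w => zeta X w * zeta Y w) =
  Er (fun w => eta X.1 w * eta X.2 w * (eta Y.1 w * eta Y.2 w))
   - (X.1 == X.2)%:R * (Y.1 == Y.2)%:R.
Proof.
have E w : zeta X w * zeta Y w = eta X.1 w * eta X.2 w * (eta Y.1 w * eta Y.2 w)
   + ((- (Y.1 == Y.2)%:R) * (eta X.1 w * eta X.2 w) +
   ((- (X.1 == X.2)%:R) * (eta Y.1 w * eta Y.2 w) + (X.1 == X.2)%:R * (Y.1 == Y.2)%:R)).
  by rewrite /zeta; ring.
have I2 := intg_mul2; have I4 := intg_mul4; have Ic := intg_cst.
have Q i j : Er (fun w => eta i w * eta j w) = (i == j)%:R by rewrite /Rintegral E2.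
under eq_Rintegral do rewrite E.
rewrite RintegralD //; last by apply: intgD; [exact: intgZ|apply: intgD => //; exact: intgZ].
rewrite RintegralD //; [|exact: intgZ|by apply: intgD => //; exact: intgZ].
rewrite RintegralD //; [|exact: intgZ].
rewrite !RintegralZl // !Q Rintegral_cst //.
rewrite [fine _](_ : _ = 1); last exact: (congr1 fine (probability_setT P)).
ring.
Qed.

(** The centred products [zeta X] and [zeta Y] are uncorrelated unless [Y] is [X] or its transpose.
    Each of these two terms costs at most [C + 1] times the squared entry, whence the factor 2. *)
Lemma quadratic_form_variance (A : T -> T -> R) : (forall a b, A a b = A b a) ->
  (\int[P]_w ((\sum_a \sum_b A a b * (eta a w * eta b w - (a == b)%:R)) ^+ 2)%:E
   <= (2 * (C + 1) * \sum_a \sum_b A a b ^+ 2)%:E)%E.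
Proof.
move=> symA; pose A' (X : T * T) := A X.1 X.2.
have E w : \sum_a \sum_b A a b * (eta a w * eta b w - (a == b)%:R) =
   \sum_X A' X * zeta X w by rewrite pair_big.
under eq_integral do rewrite E.
rewrite (Er_sum_sq _ _ _ intg_zeta) lee_fin [X in _ <= _ * X]pair_big /= mulr_sumr.
apply: ler_sum => X _.
have K0 Y : `|Er (fun w => zeta X w * zeta Y w)| <= C + 1.
  rewrite Er_zeta (le_trans (ler_normB _ _)) // lerD ?Er_mul4_le //.
  by rewrite -natrM ger0_norm ?ler0n // lern1; case: eqP; case: eqP.
have vanish Y : Y != X -> Y != (X.2, X.1) -> Er (fun w => zeta X w * zeta Y w) = 0.
  case: X Y {K0} => a b [c e] ne1 ne2; rewrite Er_zeta /= /Rintegral E22 //=.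
  by rewrite -natrM mulnb subrr.
have AA : A' (X.2, X.1) = A' X by rewrite /A' /= symA.
have single Y : A' Y = A' X ->
    A' X * A' Y * Er (fun w => zeta X w * zeta Y w) <= (C + 1) * A' X ^+ 2.
  move=> ->; rewrite -expr2 mulrC ler_wpM2r ?sqr_ge0 //.
  by rewrite (le_trans (ler_norm _)).
rewrite (bigD1 X) //= [leRHS](_ : _ = (C + 1) * A' X ^+ 2 + (C + 1) * A' X ^+ 2); last first.
  by rewrite /A'; ring.
apply: lerD; first exact: single.
have C1 : 0 <= C + 1 by exact: le_trans (K0 X).
(* A diagonal pair is its own transpose: a single term survives, and the second half of the bound is
   merely nonnegative. *)
have [eX|neX] := eqVneq (X.2, X.1) X.
  rewrite big1 => [|Y YX]; first by rewrite mulr_ge0 // sqr_ge0.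
  by rewrite vanish ?mulr0 // eX.
rewrite (bigD1 (X.2, X.1)) //= big1 ?addr0 => [|Y /andP[Y1 Y2]].
  exact: single.
by rewrite vanish ?mulr0.
Qed.

Lemma linear_form_variance (c : T -> R) :
  (\int[P]_w ((\sum_a c a * eta a w) ^+ 2)%:E = (\sum_a c a ^+ 2)%:E)%E.
Proof.
rewrite (Er_sum_sq _ _ _ intg_mul2); congr EFin; apply: eq_bigr => i _.
rewrite (bigD1 i) //= big1 ?addr0 => [|j ji]; rewrite /Rintegral E2.
  by rewrite eqxx mulr1.
by rewrite eq_sym (negPf ji) mulr0.
Qed.

End QuadraticForm.
End Moments.

(** * Second moment of the quadratic variation *)

Section HaarModel.
Context {R : realType} {d : measure_display} {Omega : measurableType d}.
Variables (pi : nat -> seq R) (a0 a1 : R) (P : probability Omega R).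
Variable eta : nat -> nat -> Omega -> R.
Hypothesis hpart : forall n, is_partition (pi n).
Hypothesis hsub : forall n, {subset pi n <= pi n.+1}.
Hypothesis h0 : pi 0%N = [:: 0; 1].
Hypothesis hmesh : mesh (pi n) @[n --> \oo] --> 0.
Hypothesis meta : forall m k, (k < nlev pi m)%N -> measurable_fun setT (eta m k).
Hypothesis E1 : forall m k, (k < nlev pi m)%N -> ('E_P[eta m k] = 0)%E.
Hypothesis E2 : forall m k m' k', (k < nlev pi m)%N -> (k' < nlev pi m')%N ->
     ('E_P[(fun w => eta m k w * eta m' k' w)%R]
        = ((m == m') && (k == k'))%:R%:E)%E.
Variable C : R.
Hypothesis E4 : forall m k, (k < nlev pi m)%N ->
     ('E_P[(fun w => eta m k w ^+ 4)%R] <= C%:E)%E.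
Hypothesis Efac : forall j1 j2 j3 j4 : nat * nat,
     (j1.2 < nlev pi j1.1)%N -> (j2.2 < nlev pi j2.1)%N ->
     (j3.2 < nlev pi j3.1)%N -> (j4.2 < nlev pi j4.1)%N ->
     j1 != j2 -> j1 != j3 -> j1 != j4 -> j2 != j3 -> j2 != j4 -> j3 != j4 ->
     forall al be ga de : nat, (al + be + ga + de = 4)%N ->
     ('E_P[(fun w => eta j1.1 j1.2 w ^+ al * eta j2.1 j2.2 w ^+ be
                    * eta j3.1 j3.2 w ^+ ga * eta j4.1 j4.2 w ^+ de)%R]
      = 'E_P[(fun w => eta j1.1 j1.2 w ^+ al)%R] * 'E_P[(fun w => eta j2.1 j2.2 w ^+ be)%R]
        * 'E_P[(fun w => eta j3.1 j3.2 w ^+ ga)%R] * 'E_P[(fun w => eta j4.1 j4.2 w ^+ de)%R])%E.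

(** * Mixed fourth moments of the coefficients *)

Local Notation ok j := (j.2 < nlev pi j.1)%N.
Let et (j : nat * nat) w := eta j.1 j.2 w.

(** Without new points beyond level [K] the mesh would stay at least that of [pi K] and could not
    tend to 0. *)
Lemma nlev_cofinal K : exists2 m, (K <= m)%N & (0 < nlev pi m)%N.
Proof.
apply: contrapT => H.
have E m : (K <= m)%N -> {subset pi m.+1 <= pi m}.
  move=> Km u um; apply: contrapT => /negP un; apply: H; exists m => //.
  have : u \in newpts pi m by rewrite mem_filter un.
  by rewrite -size_newpts //; case: (newpts pi m).
have E' m : (K <= m)%N -> {subset pi m <= pi K}.
  elim: m => [|m IH]; first by rewrite leqn0 => /eqP->.
  rewrite leq_eqVlt => /predU1P[->//|]; rewrite ltnS => Km u um.
  by apply: IH => //; exact: E um.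
have mK := mesh_gt0 _ (hpart K).
have [N HN] := cvg_exN _ _ _ hmesh mK.
have := HN _ (leq_maxr K N); rewrite subr0 ger0_norm ?(ltW (mesh_gt0 _ _)) //.
rewrite ltNge mesh_refine //; apply: E'; exact: leq_maxl.
Qed.

(* Pads a family of fewer than four indices, with exponent 0, so that the
   factorisation hypothesis applies to it. *)
Lemma fresh_index (L : seq (nat * nat)) : exists2 j, ok j & j \notin L.
Proof.
have [K HK] : exists K, forall j, j \in L -> (j.1 < K)%N.
  elim: L => [|j L [K HK]]; first by exists 0%N.
  exists (maxn j.1.+1 K) => i; rewrite inE leq_max => /orP[/eqP->|/HK->].
    by rewrite leqnn.
  by rewrite orbT.
have [m Km m0] := nlev_cofinal K; exists (m, 0%N) => //.
by apply/negP => /HK /=; rewrite ltnNge Km.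
Qed.

Let E1' j : ok j -> ('E_P[(fun w => et j w ^+ 1)%R] = 0)%E.
Proof. by move=> oj; exact: E1. Qed.

Let Esq j : ok j -> ('E_P[(fun w => et j w ^+ 2)%R] = 1)%E.
Proof. by move=> oj; have := E2 _ _ _ _ oj oj; rewrite !eqxx. Qed.

Let Eone j : ('E_P[(fun w => et j w ^+ 0)%R] = 1)%E.
Proof. by under [fun _ => _]funext do rewrite expr0; exact: expectation_cst. Qed.

(** The index [c] occurs once. After merging repetitions among [a], [b], [e] and padding with fresh
    indices, factorisation produces a first moment, which is 0. *)
Lemma moment_single0 a b e c f : ok a -> ok b -> ok e -> ok c ->
  c != a -> c != b -> c != e ->
  (forall w, f w = et a w * et b w * et e w * et c w) -> ('E_P[f] = 0)%E.
Proof.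
move=> oa ob oe oc ca cb ce fE; have -> : f = fun w => et a w * et b w * et e w * et c w.
  exact/funext.
have [x ox] := fresh_index [:: a; b; e; c].
rewrite !inE !negb_or => /and4P[xa xb xe xc].
have [y oy] := fresh_index [:: a; b; e; c; x].
rewrite !inE !negb_or => /and5P[ya yb ye yc yx].
have sq3 (p q r : nat * nat) g : ok p -> ok q -> ok r -> p != q -> p != r -> q != r ->
    x != p -> x != q -> x != r ->
    (forall w, g w = et p w ^+ 2 * et q w ^+ 1 * et r w ^+ 1 * et x w ^+ 0) -> ('E_P[g] = 0)%E.
  move=> op oq or_ pq pr qr xp xq xr gE; rewrite (funext gE).
  rewrite (Efac _ _ _ _ op oq or_ ox) // 1?eq_sym //.
  by rewrite (E1' q oq) mule0 !mul0e.
have [eab|ab] := eqVneq a b; last first.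
  have [eea|ea] := eqVneq e a; last first.
    have [eeb|eb] := eqVneq e b; last first.
      transitivity ('E_P[(fun w => et a w ^+ 1 * et b w ^+ 1 * et e w ^+ 1 * et c w ^+ 1)%R])%E => //.
      rewrite (Efac _ _ _ _ oa ob oe oc) // 1?eq_sym //.
      by rewrite (E1' c oc) mule0.
    apply: (sq3 b a c) => //; rewrite 1?eq_sym // => w.
    by rewrite eeb; ring.
  apply: (sq3 a b c) => //; rewrite 1?eq_sym // => w.
  by rewrite eea; ring.
have [eea|ea] := eqVneq e a; last first.
  apply: (sq3 a e c) => //; rewrite 1?eq_sym // => w.
  by rewrite -eab; ring.
transitivity ('E_P[(fun w => et a w ^+ 3 * et c w ^+ 1 * et x w ^+ 0 * et y w ^+ 0)%R])%E.
  by congr expectation; apply/funext => w; rewrite -eab eea; ring.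
rewrite (Efac _ _ _ _ oa oc ox oy) // 1?eq_sym //.
by rewrite (E1' c oc) mule0 !mul0e.
Qed.

(** If [a = b] and [c = e], these two indices differ and the moment is a product of two variances.
    In every other case some index occurs exactly once. *)
Lemma moment_pairs a b c e : ok a -> ok b -> ok c -> ok e ->
  (c, e) != (a, b) -> (c, e) != (b, a) ->
  ('E_P[(fun w => et a w * et b w * (et c w * et e w))%R]
    = ((a == b) && (c == e))%:R%:E)%E.
Proof.
move=> oa ob oc oe; rewrite !xpair_eqE => n1 n2.
have [eab|ab] /= := eqVneq a b; last first.
  have [ece|ce] := eqVneq c e.
    have [eca|ca] := eqVneq a c.
      apply: (moment_single0 a c e b) => //; rewrite -?ece -?eca // 1?eq_sym //.
      by move=> w; ring.
    apply: (moment_single0 b c e a) => //; rewrite -?ece //.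
    by move=> w; ring.
  have [/andP[ca cb]|] := boolP ((c != a) && (c != b)).
    by apply: (moment_single0 a b e c) => //; move=> w; ring.
  rewrite negb_and !negbK => cab.
  apply: (moment_single0 a b c e) => //; last by move=> w; ring.
  - apply/eqP => eea; move: n1 n2 cab ce; rewrite eea eqxx andbT => _ /negPf ->.
    by rewrite orbF => ->.
  - apply/eqP => eeb; move: n1 n2 cab ce; rewrite eeb eqxx andbT => /negPf -> _ /=.
    by move=> ->.
  - by rewrite eq_sym.
have [ece|ce] := eqVneq c e.
  have ac : a != c by move: n1; rewrite -ece -eab andbb eq_sym.
  have [x ox] := fresh_index [:: a; c]; rewrite !inE !negb_or => /andP[xa xc].
  have [y oy] := fresh_index [:: a; c; x]; rewrite !inE !negb_or => /and3P[ya yc yx].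
  transitivity ('E_P[(fun w => et a w ^+ 2 * et c w ^+ 2 * et x w ^+ 0 * et y w ^+ 0)%R])%E.
    by congr expectation; apply/funext => w; rewrite -eab -ece; ring.
  rewrite (Efac _ _ _ _ oa oc ox oy) // 1?eq_sym //.
  by rewrite (Esq a oa) (Esq c oc) !Eone !mule1.
have [eca|ca] := eqVneq c a.
  apply: (moment_single0 a b c e) => //; rewrite -?eab -?eca // 1?eq_sym //.
  by move=> w; ring.
by apply: (moment_single0 a b e c) => //; rewrite -?eab //; move=> w; ring.
Qed.

(** * Error of the quadratic variation of a partial sum *)

Section Level.
Variable M : nat.
(** The coefficients up to level [M] as one finite type, to which the bounds on quadratic and linear
    forms apply. *)
Let T := {m : 'I_M & 'I_(nlev pi m)}.
Let idx (j : T) : nat * nat := (nat_of_ord (tag j), nat_of_ord (tagged j)).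

Let ok_idx j : ok (idx j).
Proof. by case: j => m k /=. Qed.

Let idx_eq i j : (idx i == idx j) = (i == j).
Proof.
apply/eqP/eqP => [|->//]; case: i j => [m k] [m' k'] [] /= /val_inj mm'.
by case: _ / mm' k' => k' /val_inj ->.
Qed.

Let F j w := et (idx j) w.
Let e (j : T) s := schauder pi (tag j) (tagged j) s.

Lemma sum_level_index (V : nmodType) (G : nat -> nat -> V) :
  \sum_(m < M) \sum_(k < nlev pi m) G m k = \sum_(j : T) G (tag j) (tagged j).
Proof. by rewrite (sig_big_dep _ _ (fun (m : 'I_M) (k : 'I_(nlev pi m)) => G m k)). Qed.

Let mF j : measurable_fun setT (F j).
Proof. exact/meta/ok_idx. Qed.

Let F4 j : (\int[P]_w (F j w ^+ 4)%:E <= C%:E)%E.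
Proof. by have := E4 _ _ (ok_idx j); rewrite unlock. Qed.

Let F2 i j : (\int[P]_w (F i w * F j w)%:E = (i == j)%:R%:E)%E.
Proof. by have := E2 _ _ _ _ (ok_idx i) (ok_idx j); rewrite unlock -idx_eq. Qed.

Let F22 a b c f : (c, f) != (a, b) -> (c, f) != (b, a) ->
  (\int[P]_w ((F a w * F b w * (F c w * F f w))%:E)
    = ((a == b) && (c == f))%:R%:E)%E.
Proof.
move=> n1 n2; have := moment_pairs _ _ _ _ (ok_idx a) (ok_idx b) (ok_idx c) (ok_idx f).
rewrite unlock -!idx_eq => -> //.
- by move: n1; rewrite !xpair_eqE -!idx_eq.
- by move: n2; rewrite !xpair_eqE -!idx_eq.
Qed.

Section Time.
Variables (n : nat) (t : R).
Hypotheses (nM : (n <= M)%N) (t01 : 0 <= t <= 1).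
Let p := pi n.
Let s i := Num.min p`_i t.
Let v (i : 'I_(nint p)) j := e j (s i.+1) - e j (s i).
Let dl (i : 'I_(nint p)) := ramp p`_i p`_i.+1 t.

Let cov_v i i' : \sum_j v i j * v i' j = stopped_cov p (pi M) t i i'.
Proof.
have S u u' : 0 <= u <= 1 -> 0 <= u' <= 1 ->
   \sum_j e j u * e j u' = gram (pi M) u u' - u * u'.
  move=> u1 u'1; rewrite -(sum_schauder pi hpart hsub h0 M u u' u1 u'1).
  by rewrite (sum_level_index _ (fun m k => schauder pi m k u * schauder pi m k u')).
have s01 k : (k <= nint p)%N -> 0 <= s k <= 1 by move=> kp; exact: (stopped_itv p t (hpart n) t01).
have a1' := s01 _ (ltn_ord i); have a2 := s01 _ (ltnW (ltn_ord i)).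
have b1 := s01 _ (ltn_ord i'); have b2 := s01 _ (ltnW (ltn_ord i')).
transitivity (\sum_j e j (s i.+1) * e j (s i'.+1) - \sum_j e j (s i.+1) * e j (s i')
   - \sum_j e j (s i) * e j (s i'.+1) + \sum_j e j (s i) * e j (s i')).
  by rewrite -!sumrB -big_split /=; apply: eq_bigr => j _; rewrite /v; ring.
by rewrite !S // /stopped_cov -/(s i) -/(s i') -/(s i.+1) -/(s i'.+1); ring.
Qed.

(** The error splits into a centred quadratic form with matrix [A], the cross term with the drift
    with vector [c], and a constant [D] collecting the bias of the trace and the squared drift. *)
Let A a b := \sum_i v i a * v i b.
Let c a := \sum_i dl i * v i a.
Let D := (\sum_a A a a - t) + a1 ^+ 2 * \sum_i dl i ^+ 2.

Lemma partial_sum_index u w :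
  partial_sum pi a0 a1 eta M u w = a0 + a1 * u + \sum_(j : T) F j w * e j u.
Proof.
by rewrite /partial_sum (sum_level_index _ (fun m k => eta m k w * schauder pi m k u)).
Qed.

Let dqvE w : dqv p (fun u => partial_sum pi a0 a1 eta M u w) t - t =
  (\sum_a \sum_b A a b * (F a w * F b w - (a == b)%:R))
  + 2 * a1 * (\sum_a c a * F a w) + D.
Proof.
pose X i := \sum_j F j w * v i j.
have EX : \sum_i X i ^+ 2 = \sum_a \sum_b A a b * (F a w * F b w).
  transitivity (\sum_i \sum_a \sum_b v i a * v i b * (F a w * F b w)).
    apply: eq_bigr => i _; rewrite expr2 mulr_suml; apply: eq_bigr => a _.
    by rewrite mulr_sumr; apply: eq_bigr => b _; ring.
  rewrite exchange_big; apply: eq_bigr => a _; rewrite exchange_big.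
  by apply: eq_bigr => b _; rewrite -mulr_suml.
have ED : \sum_a \sum_b A a b * (F a w * F b w - (a == b)%:R) =
    \sum_i X i ^+ 2 - \sum_a A a a.
  rewrite EX -sumrB; apply: eq_bigr => a _.
  have -> : A a a = \sum_b A a b * (a == b)%:R.
    rewrite (bigD1 a) //= eqxx mulr1 big1 ?addr0 // => b ba.
    by rewrite eq_sym (negPf ba) mulr0.
  by rewrite -sumrB; apply: eq_bigr => b _; rewrite mulrBr.
have EC : \sum_a c a * F a w = \sum_i dl i * X i.
  transitivity (\sum_a \sum_i dl i * (F a w * v i a)).
    by apply: eq_bigr => a _; rewrite mulr_suml; apply: eq_bigr => i _; ring.
  by rewrite exchange_big; apply: eq_bigr => i _; rewrite mulr_sumr.
rewrite ED EC /D.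
have -> : dqv p (fun u => partial_sum pi a0 a1 eta M u w) t =
    \sum_i (a1 ^+ 2 * dl i ^+ 2 + 2 * a1 * (dl i * X i) + X i ^+ 2).
  apply: eq_bigr => i _; rewrite !partial_sum_index -/(s i) -/(s i.+1).
  have -> : X i = \sum_j F j w * e j (s i.+1) - \sum_j F j w * e j (s i).
    by rewrite -sumrB; apply: eq_bigr => j _; rewrite mulrBr.
  by rewrite /dl /ramp -/(s i) -/(s i.+1); ring.
rewrite !big_split /= -!mulr_sumr; ring.
Qed.

Let trace_A : \sum_a A a a = \sum_(i < nint p) stopped_cov p (pi M) t i i.
Proof. by rewrite exchange_big; apply: eq_bigr => i _; rewrite -cov_v. Qed.

(** [A] is the transpose of [v] times [v], the covariance is [v] times its transpose, and these two
    products have the same Frobenius norm. *)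
Let frob_A : \sum_a \sum_b A a b ^+ 2 =
  \sum_(i < nint p) \sum_(i' < nint p) stopped_cov p (pi M) t i i' ^+ 2.
Proof.
transitivity (\sum_a \sum_b \sum_i \sum_i' (v i a * v i' a) * (v i b * v i' b)).
  apply: eq_bigr => a _; apply: eq_bigr => b _; rewrite expr2 mulr_suml.
  by apply: eq_bigr => i _; rewrite mulr_sumr; apply: eq_bigr => i' _; ring.
transitivity (\sum_a \sum_i \sum_i' \sum_b (v i a * v i' a) * (v i b * v i' b)).
  apply: eq_bigr => a _; rewrite exchange_big; apply: eq_bigr => i _.
  by rewrite exchange_big.
rewrite exchange_big; apply: eq_bigr => i _; rewrite exchange_big.
apply: eq_bigr => i' _; rewrite -cov_v expr2 mulr_suml; apply: eq_bigr => a _.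
by rewrite mulr_sumr.
Qed.

Let norm_c : \sum_a c a ^+ 2 = \sum_(i < nint p) \sum_(i' < nint p)
  ramp p`_i p`_i.+1 t * ramp p`_i' p`_i'.+1 t * stopped_cov p (pi M) t i i'.
Proof.
transitivity (\sum_a \sum_i \sum_i' (dl i * dl i') * (v i a * v i' a)).
  apply: eq_bigr => a _; rewrite expr2 mulr_suml.
  by apply: eq_bigr => i _; rewrite mulr_sumr; apply: eq_bigr => i' _; ring.
rewrite exchange_big; apply: eq_bigr => i _; rewrite exchange_big.
by apply: eq_bigr => i' _; rewrite -cov_v mulr_sumr.
Qed.

Lemma dqv_partial_sum_L2 :
  (\int[P]_w ((dqv (pi n) (fun u => partial_sum pi a0 a1 eta M u w) t - t) ^+ 2)%:E
  <= ((24 * (C + 1) + 12 * a1 ^+ 2 + 3 * (2 + a1 ^+ 2) ^+ 2) * mesh (pi n))%:E)%E.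
Proof.
have pp := hpart n; have pq := hpart M; have sub := sub_part _ hsub _ _ nM.
pose U w := \sum_a \sum_b A a b * (F a w * F b w - (a == b)%:R).
pose W w := \sum_a c a * F a w.
have mU : measurable_fun setT U.
  apply: measurable_sum => a; apply: measurable_sum => b; apply: measurable_funM => //.
  by apply: measurable_funB => //; exact: measurable_funM.
have mW : measurable_fun setT W.
  by apply: measurable_sum => a; exact: measurable_funM.
have mU2 : measurable_fun setT (fun w => (U w ^+ 2)%:E).
  by apply/measurable_EFinP; exact: measurable_funX.
have mW2 : measurable_fun setT (fun w => (W w ^+ 2)%:E).
  by apply/measurable_EFinP; exact: measurable_funX.
have VU : (\int[P]_w (U w ^+ 2)%:E <= (2 * (C + 1) * (4 * mesh p))%:E)%E.
  have H := quadratic_form_variance P T F C mF F4 F2 F22 A.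
  apply: (le_trans (H _)); first by move=> a b; apply: eq_bigr => i _; ring.
  rewrite lee_fin frob_A.
  have C0 : 0 <= C.
    have [j oj] := fresh_index [::].
    rewrite -lee_fin (le_trans _ (E4 _ _ oj)) // unlock integral_ge0 // => w _.
    by rewrite lee_fin exprn_even_ge0.
  apply: ler_wpM2l; first by rewrite mulr_ge0 // addr_ge0.
  exact: stopped_cov_sq.
have VW : (\int[P]_w (W w ^+ 2)%:E <= (mesh p)%:E)%E.
  by rewrite (linear_form_variance P T F C mF F4 F2) lee_fin norm_c stopped_cov_lin.
(* [D] is of order [mesh p]; as [mesh p <= 1], its square is again bounded linearly in the mesh. *)
have DD : D ^+ 2 <= (2 + a1 ^+ 2) ^+ 2 * mesh p.
  have D1 : `|D| <= (2 + a1 ^+ 2) * mesh p.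
    rewrite (le_trans (ler_normD _ _)) // mulrDl lerD // ?trace_A.
      exact: stopped_cov_trace.
    have /andP[d0 d1] := sum_ramp_sq _ _ pp t01.
    have a12 : 0 <= a1 ^+ 2 by exact: sqr_ge0.
    by rewrite ger0_norm; [exact: ler_wpM2l|exact: mulr_ge0].
  have m0 := mesh_gt0 _ pp; have m1 := mesh_le1 _ pp.
  rewrite -(real_normK (num_real D)).
  have b0 : 0 <= (2 + a1 ^+ 2) ^+ 2 by exact: sqr_ge0.
  apply: (@le_trans _ _ (((2 + a1 ^+ 2) * mesh p) ^+ 2)).
    by rewrite lerXn2r // nnegrE ?(le_trans _ D1).
  by rewrite exprMn ler_wpM2l // expr2 ler_piMr // ltW.
(* A square of a sum of three terms is at most three times the sum of their squares; the middle term
   is [2 * a1 * W w], hence the coefficient 12. *)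
apply: (@le_trans _ _ (\int[P]_w (3%:E * (U w ^+ 2)%:E +
    ((12 * a1 ^+ 2)%:E * (W w ^+ 2)%:E + (3 * D ^+ 2)%:E)))%E).
  apply: ge0_le_integral => //.
  - by move=> w _; rewrite lee_fin sqr_ge0.
  - apply/measurable_EFinP; apply: measurable_funX.
    under [fun w => _]funext do rewrite dqvE.
    apply: measurable_funD => //; apply: measurable_funD => //.
    exact: measurable_funM.
  - apply: emeasurable_funD; first exact: measurable_funeM.
    by apply: emeasurable_funD => //; exact: measurable_funeM.
  - move=> w _; rewrite dqvE -/(U w) -/(W w) -!EFinM -!EFinD lee_fin.
    have h1 := sqr_ge0 (U w - 2 * a1 * W w); have h2 := sqr_ge0 (U w - D).
    have h3 := sqr_ge0 (2 * a1 * W w - D); lra.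
have ge3 : (0 <= 3%:E :> \bar R)%E by rewrite lee_fin.
have ge12 : (0 <= (12 * a1 ^+ 2)%:E :> \bar R)%E by rewrite lee_fin mulr_ge0 // sqr_ge0.
have geD : (0 <= (3 * D ^+ 2)%:E :> \bar R)%E by rewrite lee_fin mulr_ge0 // sqr_ge0.
have gU w : (0 <= (U w ^+ 2)%:E)%E by rewrite lee_fin sqr_ge0.
have gW w : (0 <= (W w ^+ 2)%:E)%E by rewrite lee_fin sqr_ge0.
rewrite ge0_integralD //; last 4 first.
- by move=> w _; rewrite mule_ge0.
- exact: measurable_funeM.
- by move=> w _; rewrite adde_ge0 // mule_ge0.
- by apply: emeasurable_funD => //; exact: measurable_funeM.
rewrite ge0_integralD //; last 2 first.
- by move=> w _; rewrite mule_ge0.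
- exact: measurable_funeM.
rewrite !ge0_integralZl // integral_cst //.
rewrite [X in ((3 * D ^+ 2)%:E * X)%E](_ : _ = 1%E); last exact: probability_setT.
rewrite mule1.
apply: (@le_trans _ _ (3%:E * (2 * (C + 1) * (4 * mesh p))%:E +
  ((12 * a1 ^+ 2)%:E * (mesh p)%:E + (3 * D ^+ 2)%:E))%E).
  by apply: leeD; [exact: lee_wpmul2l|apply: leeD => //; exact: lee_wpmul2l].
rewrite -!EFinM -!EFinD lee_fin -/p; lra.
Qed.

End Time.
End Level.
End HaarModel.

(** * Almost sure convergence *)

Section AlmostSure.
Context {R : realType} {d : measure_display} {Omega : measurableType d}.
Variable P : probability Omega R.

(** By monotone convergence the series of the [f n] is integrable, so almost surely finite; its sum
    bounds every term and its terms tend to 0. *)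
Lemma ae_summable (f : nat -> Omega -> R) (C q : R) :
  (forall n, measurable_fun setT (f n)) -> (forall n w, 0 <= f n w) ->
  0 <= q < 1 -> 0 <= C -> (forall n, (\int[P]_w (f n w)%:E <= (C * q ^+ n)%:E)%E) ->
  {ae P, forall w, f n w @[n --> \oo] --> 0 /\ exists B, forall n, f n w <= B}.
Proof.
move=> mf f0 /andP[q0 q1] C0 If.
have mfE n : measurable_fun setT (fun w => (f n w)%:E) by exact/measurable_EFinP.
have f0E n w : (0 <= (f n w)%:E)%E by rewrite lee_fin.
pose g w := (\sum_(0 <= n <oo) (f n w)%:E)%E.
have q1' : 0 < 1 - q by rewrite subr_gt0.
have geo n : \sum_(0 <= k < n) C * q ^+ k <= C / (1 - q).
  rewrite -mulr_sumr ler_wpM2l //.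
  have -> : \sum_(0 <= k < n) q ^+ k = (1 - q ^+ n) / (1 - q).
    apply: (mulIf (lt0r_neq0 q1')); rewrite divfK ?lt0r_neq0 // mulr_suml.
    under eq_bigr do rewrite mulrBr mulr1 -exprSr -opprB.
    by rewrite sumrN telescope_sumr // expr0 opprB.
  by rewrite -[leRHS]mul1r ler_wpM2r ?invr_ge0 ?(ltW q1') // gerBl exprn_ge0.
have Ig : (\int[P]_w g w <= (C / (1 - q))%:E)%E.
  rewrite integral_nneseries //; apply: lime_le.
    by apply: is_cvg_nneseries => n _ _; exact: integral_ge0.
  apply: nearW => n; apply: (@le_trans _ _ (\sum_(0 <= k < n) (C * q ^+ k)%:E)%E).
    by apply: lee_sum => k _; exact: If.
  by rewrite sumEFin lee_fin.
have g0 w : (0 <= g w)%E by exact: nneseries_ge0.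
have ig : P.-integrable setT g.
  apply/integrableP; split.
    by apply: ge0_emeasurable_sum => // n _; exact: mfE.
  under eq_integral => w _ do rewrite gee0_abs //.
  by rewrite (le_lt_trans Ig) // ltry.
apply: filterS (integrable_ae measurableT ig) => w /(_ I) gfin.
have S n : \sum_(0 <= k < n) f k w <= fine (g w).
  rewrite -lee_fin fineK // -sumEFin; apply: nneseries_lim_ge => k _ _; exact: f0E.
split.
  apply: cvg_series_cvg_0; apply: nondecreasing_is_cvgn.
    by apply: nondecreasing_series => k _ _; exact: f0.
  by exists (fine (g w)) => _ [n _ <-]; exact: S.
exists (fine (g w)) => n; apply: le_trans (S n.+1).
by rewrite big_nat_recr //= lerDr sumr_ge0.
Qed.

End AlmostSure.

(** * Uniform convergence of a Schauder series with decaying coefficients *)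

Section SeriesPath.
Context {R : realType}.
Variables (pi : nat -> seq R) (a0 a1 : R) (c : nat -> nat -> R) (K : nat) (B kap : R).
Hypothesis hpart : forall n, is_partition (pi n).
Hypothesis hsub : forall n, {subset pi n <= pi n.+1}.
Hypothesis hK : forall n (i : nat), (i < nint (pi n))%N ->
  leq (count (fun s => ((pi n)`_i <= s) && (s <= (pi n)`_i.+1)) (pi n.+1)) K.
Hypothesis kap01 : 0 <= kap < 1.
Hypothesis B0 : 0 <= B.
Hypothesis hc : forall m k, (k < nlev pi m)%N ->
  `|c m k| * Num.sqrt (mesh (pi m.+1)) <= B * kap ^+ m.

Let S M t := a0 + a1 * t + \sum_(m < M) \sum_(k < nlev pi m) c m k * schauder pi m k t.
(** The geometric tail of the level bounds [K * B * kap ^ m] over [m >= M]. *)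
Let tau M := K%:R * B / (1 - kap) * kap ^+ M.

Let k1 : 0 < 1 - kap. Proof. by rewrite subr_gt0; case/andP: kap01. Qed.

Let term_le m t : 0 <= t <= 1 ->
  `|\sum_(k < nlev pi m) c m k * schauder pi m k t| <= K%:R * (B * kap ^+ m).
Proof.
move=> t01; apply: sum_schauder_bound => //; [exact: hK|exact: hc|].
by rewrite mulr_ge0 // exprn_ge0 //; case/andP: kap01.
Qed.

Let tau_step m : tau m = K%:R * (B * kap ^+ m) + tau m.+1.
Proof. by rewrite /tau exprS; field; rewrite lt0r_neq0. Qed.

Let tau_ge0 m : 0 <= tau m.
Proof.
rewrite /tau; case/andP: kap01 => k0 _.
by rewrite mulr_ge0 ?exprn_ge0 // divr_ge0 ?(ltW k1) // mulr_ge0.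
Qed.

Let S_diff M n t : 0 <= t <= 1 -> `|S (M + n) t - S M t| <= tau M - tau (M + n)%N.
Proof.
move=> t01; elim: n => [|n IH]; first by rewrite addn0 !subrr normr0.
rewrite addnS /S big_ord_recr /= addrA -/(S (M + n) t).
rewrite addrAC (le_trans (ler_normD _ _)) //.
have := term_le (M + n) t t01; have := tau_step (M + n); lra.
Qed.

Let tau_cvg : tau M @[M --> \oo] --> 0.
Proof.
apply: cvg_geometric; case/andP: kap01 => ? ?.
by rewrite ger0_norm.
Qed.

Lemma series_path_cvg t : 0 <= t <= 1 -> cvgn (fun M => S M t).
Proof.
move=> t01; apply: cauchy_cvg; apply/cauchyP => e e0.
have [M HM] := cvg_exN _ _ _ tau_cvg e0.
exists (S M t); exists M => // n /= Mn.
rewrite /ball /= -(subnKC Mn) distrC (le_lt_trans (S_diff M (n - M) t t01)) //.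
have := HM M (leqnn _); rewrite subr0 ger0_norm //; have := tau_ge0 (M + (n - M))%N; lra.
Qed.

Lemma series_path_tail M t : 0 <= t <= 1 ->
  `|limn (fun N => S N t) - S M t| <= tau M.
Proof.
move=> t01; rewrite leNgt; apply/negP => h.
have e0 : 0 < `|limn (fun N => S N t) - S M t| - tau M by rewrite subr_gt0.
have [N HN] := cvg_exN _ _ _ (series_path_cvg t t01) e0.
have := HN (M + N)%N (leq_addl _ _).
have := S_diff M N t t01; have := tau_ge0 (M + N)%N.
have := ler_distD (S (M + N) t) (limn (fun N => S N t)) (S M t).
by rewrite [`|limn _ - S (M + N) t|]distrC; lra.
Qed.

Lemma series_path_unif_continuous e : 0 < e -> exists2 dl, 0 < dl &
  forall u v, 0 <= u <= 1 -> 0 <= v <= 1 -> `|u - v| < dl ->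
  `|limn (fun N => S N u) - limn (fun N => S N v)| < e.
Proof.
move=> e0; have e4 : 0 < e / 4 by lra.
have [M /(_ M (leqnn _))] := cvg_exN _ _ _ tau_cvg e4.
rewrite subr0 ger0_norm // => tM.
have [L L0 HL] : lipschitz (S M).
  apply: lipschitzD.
    by apply: lipschitzD; [exact: lipschitz_cst|apply: lipschitzZ; exact: lipschitz_id].
  apply: (lipschitz_sum M (fun m u => \sum_(k < nlev pi m) c m k * schauder pi m k u)) => m _.
  apply: (lipschitz_sum _ (fun k u => c m k * schauder pi m k u)) => k km.
  by apply: lipschitzZ; exact: lipschitz_schauder.
(* Dividing by [L + 1] covers the case [L = 0]. *)
have L1 : 0 < L + 1 by lra.
exists (e / 4 / (L + 1)); first by rewrite divr_gt0.
move=> u v u01 v01; rewrite ltr_pdivlMr // => uv.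
have := series_path_tail M u u01; have := series_path_tail M v v01.
have hL := HL u v.
have hL' : L * `|u - v| <= `|u - v| * (L + 1) by have := normr_ge0 (u - v); lra.
have := ler_distD (S M u) (limn (fun N => S N u)) (limn (fun N => S N v)).
have := ler_distD (S M v) (S M u) (limn (fun N => S N v)).
by rewrite [`|S M v - _|]distrC; lra.
Qed.

End SeriesPath.

(** * Convergence in probability *)

Section Convergence.
Context {R : realType} {d : measure_display} {Omega : measurableType d}.
Variables (pi : nat -> seq R) (a0 a1 : R) (P : probability Omega R).
Variables (eta : nat -> nat -> Omega -> R) (Kc : R).
Hypothesis hpart : forall n, is_partition (pi n).
Hypothesis hsub : forall n, {subset pi n <= pi n.+1}.
Hypothesis hmesh : mesh (pi n) @[n --> \oo] --> 0.
Hypothesis meta : forall m k, (k < nlev pi m)%N -> measurable_fun setT (eta m k).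
Hypothesis Kc0 : 0 <= Kc.

Local Notation S M t w := (partial_sum pi a0 a1 eta M t w).

Hypothesis dqvL2 : forall n M (t : R), (n <= M)%N -> 0 <= t <= 1 ->
  (\int[P]_w ((dqv (pi n) (fun u => S M u w) t - t) ^+ 2)%:E <= (Kc * mesh (pi n))%:E)%E.

Lemma measurable_partial_sum M t : measurable_fun setT (fun w => S M t w).
Proof.
apply: measurable_funD => //; apply: measurable_sum => m; apply: measurable_sum => k.
by apply: measurable_funM => //; exact: meta.
Qed.

Lemma measurable_dqv p (x : R -> Omega -> R) (t : R) : is_partition p -> 0 <= t <= 1 ->
  (forall u : R, 0 <= u <= 1 -> measurable_fun setT (x u)) ->
  measurable_fun setT (fun w => dqv p (fun u => x u w) t).
Proof.
move=> pp t01 mx; apply: measurable_sum => i; apply: measurable_funX.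
by apply: measurable_funB; apply: mx; apply: stopped_itv => //; exact: ltnW.
Qed.

(** Young's inequality with weight [th], applied to the term [2 b (a - b)] of the difference. *)
Lemma sqr_diff_le (a b th : R) : 0 < th ->
  `|a ^+ 2 - b ^+ 2| <= (1 + th^-1) * (a - b) ^+ 2 + th * b ^+ 2.
Proof.
move=> th0; have h : 0 <= th^-1 * (a - b - th * b) ^+ 2 by rewrite mulr_ge0 ?sqr_ge0 // invr_ge0 ltW.
have h' : 0 <= th^-1 * (a - b + th * b) ^+ 2 by rewrite mulr_ge0 ?sqr_ge0 // invr_ge0 ltW.
have e1 : th^-1 * (a - b - th * b) ^+ 2 = th^-1 * (a - b) ^+ 2 - 2 * b * (a - b) + th * b ^+ 2.
  by field; rewrite lt0r_neq0.
have e2 : th^-1 * (a - b + th * b) ^+ 2 = th^-1 * (a - b) ^+ 2 + 2 * b * (a - b) + th * b ^+ 2.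
  by field; rewrite lt0r_neq0.
have := sqr_ge0 (a - b).
by rewrite ler_norml => ?; apply/andP; split; lra.
Qed.

Lemma dqv_perturb p (x y : R -> R) (t th : R) : 0 < th ->
  `|dqv p x t - dqv p y t| <= th * dqv p y t + (1 + th^-1) * (2 *
    \sum_(i < nint p) ((y (Num.min p`_i.+1 t) - x (Num.min p`_i.+1 t)) ^+ 2 +
      (y (Num.min p`_i t) - x (Num.min p`_i t)) ^+ 2)).
Proof.
move=> th0; rewrite /dqv -sumrB (le_trans (ler_norm_sum _ _ _)) //.
rewrite !mulr_sumr -big_split /=; apply: ler_sum => i _.
rewrite (le_trans (sqr_diff_le _ _ _ th0)) // [leLHS]addrC lerD2l ler_wpM2l //.
  by rewrite addr_ge0 // invr_ge0 ltW.
set a := x _; set b := x _; set a' := y _; set b' := y _.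
have := sqr_ge0 ((a' - a) + (b' - b)); lra.
Qed.

Section InProbability.
Variable x : R -> Omega -> R.
Hypothesis mx : forall t : R, 0 <= t <= 1 -> measurable_fun setT (x t).
Hypothesis hx : forall t e : R, 0 <= t <= 1 -> 0 < e -> exists N, forall M, (N <= M)%N ->
  (\int[P]_w ((S M t w - x t w) ^+ 2)%:E <= e%:E)%E.

(** For fixed [n], a large [M] makes [S M] close to [x] in mean square at the finitely many stopped
    points; Chebyshev's inequality and the bound for [S M] then apply. *)
Lemma dqv_deviation n (t eps : R) : 0 <= t <= 1 -> 0 < eps ->
  (P [set w | (eps < `|dqv (pi n) (fun s => x s w) t - t|)%R]
   <= (((eps / 4)^-1 ^+ 2 * Kc + 1) * mesh (pi n))%:E)%E.
Proof.
move=> t01 e0; set p := pi n; have pp := hpart n : is_partition p.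
(* Both caps serve to bound [th * Q']: by 1 for its part [th * Dv w], by [eps / 4] for its part
   [th * t]. *)
pose th := Num.min 1 (eps / 4).
have e4 : 0 < eps / 4 by lra.
have th0 : 0 < th by rewrite lt_min ltr01.
have th1 : th <= 1 by rewrite ge_min lexx.
have the : th <= eps / 4 by rewrite ge_min lexx orbT.
pose c1 := (eps / 4)^-1 ^+ 2; pose c2 := (eps / 4)^-1 * ((1 + th^-1) * 2).
have c10 : 0 <= c1 by exact: sqr_ge0.
have c20 : 0 < c2.
  rewrite /c2 mulr_gt0 ?invr_gt0 // mulr_gt0 // addr_gt0 // invr_gt0.
  exact: th0.
pose s i := Num.min p`_i t.
have s01 i : (i <= nint p)%N -> 0 <= s i <= 1 by move=> ip; exact: stopped_itv.
have m0 := mesh_gt0 _ pp; have N0 := nint_gt0 _ pp.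
(* Chosen so that [c2] times the total of [2 * e'] over all intervals of [p] is exactly [mesh p]. *)
pose e' := mesh p / (c2 * (2 * (nint p)%:R)).
have N0' : 0 < (nint p)%:R :> R by rewrite ltr0n.
have e'0 : 0 < e' by rewrite divr_gt0 // mulr_gt0 // mulr_gt0.
have [N HN] : exists N, forall M, (N <= M)%N -> forall i, (i < (nint p).+1)%N ->
    (\int[P]_w ((S M (s i) w - x (s i) w) ^+ 2)%:E <= e'%:E)%E.
  by apply: exN_forall_lt => i ip; apply: hx => //; exact: s01.
pose M := maxn n N; have HM := HN M (leq_maxr _ _); have nM : (n <= M)%N := leq_maxl _ _.
pose Dv w := dqv p (fun u => S M u w) t - t.
pose r i w := (S M (s i) w - x (s i) w) ^+ 2.
pose A := [set w | eps < `|dqv p (fun s => x s w) t - t|].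
have mA : measurable A.
  have mf : measurable_fun setT (fun w => `|dqv p (fun s => x s w) t - t|).
    apply: measurableT_comp => //; apply: measurable_funB => //.
    exact: measurable_dqv.
  rewrite (_ : A = setT `&` [set w | eps < `|dqv p (fun s => x s w) t - t|]); last by rewrite setTI.
  rewrite -preimage_itvoy; exact: mf.
have mr i : (i <= nint p)%N -> measurable_fun setT (r i).
  move=> ip; apply: measurable_funX; apply: measurable_funB; last exact/mx/s01.
  exact: measurable_partial_sum.
have mD : measurable_fun setT (fun w => Dv w ^+ 2).
  apply: measurable_funX; apply: measurable_funB => //; apply: measurable_dqv => // u u01.
  exact: measurable_partial_sum.
have r0 i w : 0 <= r i w by exact: sqr_ge0.
(* A deviation above [eps] forces either [Dv w] to reach [eps / 4] in absolute value or the
   perturbation term to exceed [eps / 4]. *)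
have key w : A w -> 1 <= c1 * Dv w ^+ 2 + c2 * \sum_(i < nint p) (r i.+1 w + r i w).
  rewrite /A /= => Aw.
  have := dqv_perturb p (fun s => x s w) (fun u => S M u w) t th th0.
  rewrite -[X in (1 + _) * (2 * X)]/(\sum_(i < nint p) (r i.+1 w + r i w)).
  set Q := dqv p (fun s => x s w) t in Aw *; set Q' := dqv p _ t.
  have eD : Dv w = Q' - t by [].
  set T := \sum_(i < nint p) _; have T0 : 0 <= T by apply: sumr_ge0 => i _; exact: addr_ge0.
  move=> h.
  have c2E : c2 * T = (eps / 4)^-1 * ((1 + th^-1) * (2 * T)) by rewrite /c2; ring.
  set U := (1 + th^-1) * (2 * T) in h c2E *.
  have U0 : 0 <= U by rewrite mulr_ge0 ?addr_ge0 ?invr_ge0 ?mulr_ge0 ?(ltW th0).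
  have [dv|dv] := leP (eps / 4) `|Dv w|.
    have : 1 <= c1 * Dv w ^+ 2.
      rewrite /c1 -exprMn -real_normK ?num_real // normrM exprn_ege1 //.
      by rewrite gtr0_norm ?invr_gt0 // mulrC ler_pdivlMr // mul1r.
    by have := mulr_ge0 (ltW c20) T0; lra.
  have d0 : 0 <= c1 * Dv w ^+ 2 by rewrite mulr_ge0 // sqr_ge0.
  suff : 1 <= c2 * T by lra.
  rewrite c2E mulrC ler_pdivlMr // mul1r.
  have h1 : `|Q - t| <= `|Q - Q'| + `|Dv w| by rewrite eD; exact: ler_distD.
  have h2 : th * Q' <= `|Dv w| + eps / 4.
    have q1 : th * Q' = th * Dv w + th * t by rewrite eD; ring.
    have q2 : th * Dv w <= `|Dv w|.
      rewrite (le_trans (ler_norm _)) // normrM (gtr0_norm th0) ler_piMl //.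
    have q3 : th * t <= eps / 4.
      case/andP: t01 => t0 t1; rewrite (le_trans _ the) // ler_piMr // ltW //.
    lra.
  lra.
have -> : P A = (\int[P]_w (\1_A w)%:E)%E by rewrite integral_indic // setIT.
pose G w := (c1%:E * (Dv w ^+ 2)%:E + c2%:E * (\sum_(i < nint p) ((r i.+1 w)%:E + (r i w)%:E)))%E.
have mrE i : (i <= nint p)%N -> measurable_fun setT (fun w => (r i w)%:E).
  by move=> ip; apply/measurable_EFinP; exact: mr.
have mDE : measurable_fun setT (fun w => (Dv w ^+ 2)%:E) by exact/measurable_EFinP.
have mT (i : 'I_(nint p)) : measurable_fun setT (fun w => (r i.+1 w)%:E + (r i w)%:E)%E.
  by apply: emeasurable_funD; apply: mrE => //; exact: ltnW.
have r0E i w : (0 <= (r i w)%:E)%E by rewrite lee_fin.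
have T0E (i : 'I_(nint p)) w : (0 <= (r i.+1 w)%:E + (r i w)%:E)%E by exact: adde_ge0.
have mS : measurable_fun setT (fun w => \sum_(i < nint p) ((r i.+1 w)%:E + (r i w)%:E))%E.
  exact: emeasurable_sum.
have S0E w : (0 <= \sum_(i < nint p) ((r i.+1 w)%:E + (r i w)%:E))%E by exact: sume_ge0.
have D0E w : (0 <= (Dv w ^+ 2)%:E)%E by rewrite lee_fin sqr_ge0.
have c1E : (0 <= c1%:E)%E by rewrite lee_fin.
have c2E : (0 <= c2%:E)%E by rewrite lee_fin ltW.
apply: (@le_trans _ _ (\int[P]_w G w)%E).
  apply: ge0_le_integral => //.
  - by apply/measurable_EFinP; exact: measurable_indic.
  - by apply: emeasurable_funD; exact: measurable_funeM.
  - move=> w _; rewrite /G.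
    have -> : (\sum_(i < nint p) ((r i.+1 w)%:E + (r i w)%:E) =
        (\sum_(i < nint p) (r i.+1 w + r i w))%:E)%E by rewrite -sumEFin.
    rewrite -!EFinM -EFinD lee_fin indicE.
    have [/set_mem/key //|_] := boolP (w \in A).
    rewrite addr_ge0 // mulr_ge0 ?sqr_ge0 ?(ltW c20) //.
    by apply: sumr_ge0 => i _; exact: addr_ge0.
rewrite /G ge0_integralD //; last 4 first.
- by move=> w _; exact: mule_ge0.
- exact: measurable_funeM.
- by move=> w _; exact: mule_ge0.
- exact: measurable_funeM.
rewrite !ge0_integralZl // ge0_integral_sum //.
have I1 : (\sum_(i < nint p) \int[P]_w ((r i.+1 w)%:E + (r i w)%:E)
    <= (\sum_(i < nint p) (e' + e'))%:E)%E.
  rewrite -sumEFin; apply: lee_sum => i _.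
  have ip := ltn_ord i.
  rewrite ge0_integralD //; [|exact: mrE|exact: mrE (ltnW _)].
  by rewrite EFinD leeD //; apply: HM => //; exact: ltnW.
apply: (@le_trans _ _ (c1%:E * (Kc * mesh p)%:E + c2%:E * (\sum_(i < nint p) (e' + e'))%:E)%E).
  by apply: leeD; apply: lee_wpmul2l => //; exact: dqvL2.
rewrite -!EFinM -EFinD lee_fin sumr_const card_ord.
have -> : c2 * ((e' + e') *+ nint p) = mesh p.
  by rewrite -[X in _ * X = _]mulr_natl /e'; field; rewrite !lt0r_neq0.
by rewrite mulrDl mul1r mulrA.
Qed.

Lemma dqv_cvg_in_probability (t eps : R) : 0 <= t <= 1 -> 0 < eps ->
  (P [set w | (eps < `|dqv (pi n) (fun s => x s w) t - t|)%R] @[n --> \oo] --> 0)%E.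
Proof.
move=> t01 e0; set k := (eps / 4)^-1 ^+ 2 * Kc + 1.
apply: (@squeeze_cvge _ _ _ _ (cst 0%E) _ (fun n => (k * mesh (pi n))%:E)).
- by apply: nearW => n; rewrite measure_ge0 /=; exact: dqv_deviation.
- exact: cvg_cst.
- apply: cvg_EFin; first exact: nearW.
  have -> : 0 = k * 0 by rewrite mulr0.
  exact: cvgMr.
Qed.

End InProbability.
End Convergence.

(** * The continuous version *)

Section MeshDecay.
Context {R : realType}.
Variable pi : nat -> seq R.
Hypothesis hpart : forall n, is_partition (pi n).
Hypothesis hsub : forall n, {subset pi n <= pi n.+1}.

Lemma mesh_geometric : complete_refining pi -> exists D rho : R,
  [/\ 0 <= D, 0 < rho < 1 & forall n, mesh (pi n) <= D * rho ^+ n].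
Proof.
move=> [eps [M' [e0 H]]]; have e1 : 0 < 1 + eps by lra.
(* The ratio bound starts at level 1; the constant [1 + eps] absorbs the step from level 0. *)
exists (1 + eps), (1 + eps)^-1; split; first exact: ltW.
  by rewrite invr_gt0 e1 invf_lt1 //; lra.
elim=> [|n IH]; first by rewrite mulr1 (le_trans (mesh_le1 _ (hpart 0))) //; lra.
case: n IH => [|n] IH.
  by rewrite expr1 divff ?lt0r_neq0 // mesh_le1.
have /andP[h _] := H n.+1 isT.
rewrite exprSr mulrA ler_pdivlMr // (le_trans _ IH) //.
by move: h; rewrite ler_pdivlMr ?mesh_gt0 // mulrC.
Qed.

(** By balance [mesh p] is at most a constant times every step of [p], and the steps sum to 1. *)
Lemma nint_mesh_bounded : balanced pi -> exists2 Cb : R, 0 <= Cb &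
  forall m, (nlev pi m)%:R * mesh (pi m.+1) <= Cb.
Proof.
move=> [Cb H]; exists `|Cb| => // m; set p := pi m.+1; have pp := hpart m.+1 : is_partition p.
have ms0 : 0 <= minstep p.
  apply: le_bigmin => // i _; rewrite subr_ge0 ltW // nth_part_lt //.
apply: (@le_trans _ _ ((nint p)%:R * mesh p)).
  by rewrite ler_wpM2r ?(ltW (mesh_gt0 _ pp)) // ler_nat leq_subr.
have mC : mesh p <= `|Cb| * minstep p.
  by rewrite (le_trans (H m.+1 isT)) // ler_wpM2r // ler_norm.
have -> : (nint p)%:R * mesh p = \sum_(i < nint p) mesh p.
  by rewrite sumr_const card_ord mulr_natl.
apply: (@le_trans _ _ (\sum_(i < nint p) `|Cb| * ramp p`_i p`_i.+1 1)).
  apply: ler_sum => i _; rewrite (le_trans mC) // ler_wpM2l //.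
  rewrite ramp_ge; first exact: bigmin_le.
    by rewrite ltW // nth_part_lt.
  by case/andP: (part_itv _ _ pp (mem_nth_part _ i.+1 pp (ltn_ord i))).
by rewrite -mulr_sumr sum_ramp ?mulr1 // ler01 lexx.
Qed.

End MeshDecay.

(** * Path regularity and almost sure convergence at partition points *)

Section PathRegularity.
Context {R : realType} {d : measure_display} {Omega : measurableType d}.
Variables (pi : nat -> seq R) (a0 a1 : R) (P : probability Omega R).
Variables (eta : nat -> nat -> Omega -> R) (Kc C D rho Cb : R) (K : nat).
Hypothesis hpart : forall n, is_partition (pi n).
Hypothesis hsub : forall n, {subset pi n <= pi n.+1}.
Hypothesis hmesh : mesh (pi n) @[n --> \oo] --> 0.
Hypothesis hK : forall n (i : nat), (i < nint (pi n))%N ->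
  leq (count (fun s => ((pi n)`_i <= s) && (s <= (pi n)`_i.+1)) (pi n.+1)) K.
Hypothesis meta : forall m k, (k < nlev pi m)%N -> measurable_fun setT (eta m k).
Hypothesis C0 : 0 <= C.
Hypothesis eta4 : forall m k, (k < nlev pi m)%N ->
  (\int[P]_w (eta m k w ^+ 4)%:E <= C%:E)%E.
Hypothesis Kc0 : 0 <= Kc.

Local Notation S M t w := (partial_sum pi a0 a1 eta M t w).

Hypothesis dqvL2 : forall n M (t : R), (n <= M)%N -> 0 <= t <= 1 ->
  (\int[P]_w ((dqv (pi n) (fun u => S M u w) t - t) ^+ 2)%:E <= (Kc * mesh (pi n))%:E)%E.
Hypothesis D0 : 0 <= D.
Hypothesis rho01 : 0 < rho < 1.
Hypothesis hD : forall n, mesh (pi n) <= D * rho ^+ n.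
Hypothesis Cb0 : 0 <= Cb.
Hypothesis hCb : forall m, (nlev pi m)%:R * mesh (pi m.+1) <= Cb.

(* By Bernoulli's inequality, rho < kap ^ 4 < 1. *)
Let kap := 1 - (1 - rho) / 8.

Let kap01 : 0 < kap < 1.
Proof. by move: rho01; rewrite /kap => /andP[? ?]; apply/andP; split; lra. Qed.

Let rho_kap : rho < kap ^+ 4.
Proof.
case/andP: rho01 => r0 r1; rewrite /kap; set x := (1 - rho) / 8.
have -> : rho = 1 - 8 * x by rewrite /x; field.
have x0 : 0 < x by rewrite /x; lra.
have x1 : x < 1 by rewrite /x; lra.
have h : 1 - 2 * x <= (1 - x) ^+ 2 by have := sqr_ge0 x; lra.
have -> : (1 - x) ^+ 4 = ((1 - x) ^+ 2) ^+ 2 by rewrite -exprM.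
have := sqr_ge0 (1 - x); have := sqr_ge0 ((1 - x) ^+ 2 - (1 - 2 * x)); nra.
Qed.

(** Fourth powers summed over a level have mean at most [C * nlev pi m]. Of the two factors [mesh]
    in [al], one compensates the number of functions and the other supplies [rho ^ m], which beats
    [kap ^ (4 m)]. *)
Lemma coefficients_decay : {ae P, forall w, exists2 B, 0 <= B & forall m k,
  (k < nlev pi m)%N -> `|eta m k w| * Num.sqrt (mesh (pi m.+1)) <= B * kap ^+ m}.
Proof.
case/andP: kap01 => k0 k1; case/andP: rho01 => r0 r1.
have k40 n : 0 < kap ^+ n by exact: exprn_gt0.
pose al m := mesh (pi m.+1) ^+ 2 / (kap ^+ 4) ^+ m.
have al0 m : 0 <= al m by rewrite divr_ge0 ?sqr_ge0 // exprn_ge0 // ltW.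
pose f m w := al m * \sum_(k < nlev pi m) eta m k w ^+ 4.
have q4 m k w : 0 <= eta m k w ^+ 4 by rewrite exprn_even_ge0.
have m4 m (k : 'I_(nlev pi m)) : measurable_fun setT (fun w => (eta m k w ^+ 4)%:E).
  by apply/measurable_EFinP; apply: measurable_funX; exact: meta.
have mf m : measurable_fun setT (f m).
  apply: measurable_funM => //; apply: measurable_sum => k.
  by apply: measurable_funX; exact: meta.
have f0 m w : 0 <= f m w by rewrite mulr_ge0 // sumr_ge0.
have rk : 0 <= rho / kap ^+ 4 < 1.
  by rewrite divr_ge0 ?(ltW r0) ?(ltW (k40 _)) //= ltr_pdivrMr // mul1r.
have If m : (\int[P]_w (f m w)%:E <= ((D * Cb * C) * (rho / kap ^+ 4) ^+ m)%:E)%E.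
  rewrite /f; under eq_integral do rewrite EFinM -sumEFin.
  rewrite ge0_integralZl //; last 3 first.
  - exact: emeasurable_sum.
  - by move=> w _; apply: sume_ge0 => k _; rewrite lee_fin.
  - by rewrite lee_fin.
  rewrite ge0_integral_sum //; last by move=> k w _; rewrite lee_fin.
  apply: (@le_trans _ _ ((al m)%:E * (\sum_(k < nlev pi m) C)%:E)%E).
    apply: lee_wpmul2l; first by rewrite lee_fin.
    by rewrite -sumEFin; apply: lee_sum => k _; exact: eta4.
  rewrite -EFinM lee_fin sumr_const card_ord /al expr_div_n.
  set h := mesh _; set N := nlev pi m; set z := (kap ^+ 4) ^+ m.
  have z0 : 0 < z by rewrite exprn_gt0.
  have h0 : 0 <= h by exact/ltW/mesh_gt0.
  have hr : h <= D * rho ^+ m.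
    by rewrite (le_trans _ (hD m)) // mesh_refine //; exact: hsub.
  have hh : h * (N%:R * h) <= D * rho ^+ m * Cb.
    apply: ler_pM => //; [by rewrite mulr_ge0|exact: hCb].
  rewrite -[C *+ N]mulr_natr.
  rewrite [leLHS](_ : _ = h * (N%:R * h) * (C / z)); last by ring.
  rewrite [leRHS](_ : _ = D * rho ^+ m * Cb * (C / z)); last by ring.
  by rewrite ler_wpM2r // divr_ge0 // ltW.
have DC : 0 <= D * Cb * C by rewrite !mulr_ge0.
apply: filterS (ae_summable P f _ _ mf f0 rk DC If) => w [_ [B HB]].
have B0 : 0 <= B by exact: le_trans (f0 0%N w) (HB 0%N).
(* Since [B <= (B + 1) ^ 4], no fourth root of [B] has to be taken. *)
exists (B + 1) => [|m k km]; first by rewrite addr_ge0.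
have h0 : 0 <= mesh (pi m.+1) by exact/ltW/mesh_gt0.
rewrite -(@ler_pXn2r _ 4) ?nnegrE ?mulr_ge0 ?sqrtr_ge0 ?addr_ge0 ?(ltW (k40 _)) //.
have -> : (`|eta m k w| * Num.sqrt (mesh (pi m.+1))) ^+ 4 =
    mesh (pi m.+1) ^+ 2 * eta m k w ^+ 4.
  rewrite exprMn -normrX (ger0_norm (q4 _ _ _)) mulrC; congr (_ * _).
  by rewrite (exprM _ 2 2) sqr_sqrtr.
have z0 : 0 < (kap ^+ 4) ^+ m by rewrite exprn_gt0.
rewrite exprMn -exprM (mulnC m) exprM -ler_pdivrMr //.
apply: (@le_trans _ _ B); last first.
  have B1 : 1 <= B + 1 by lra.
  apply: (@le_trans _ _ (B + 1)); first lra.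
  by rewrite -[leLHS]expr1 ler_weXn2l.
apply: le_trans (HB m).
rewrite /f (bigD1 (Ordinal km)) //= mulrDr /al mulrAC lerDl mulr_ge0 //.
  by rewrite divr_ge0 ?sqr_ge0 // ltW.
by apply: sumr_ge0.
Qed.

(** A limit taken path by path; where the partial sums diverge, on a null set, its value is
    immaterial. *)
Definition path_version t w : R := limn (fun M => S M t w).
Local Notation X := path_version.

Let kap01' : 0 <= kap < 1.
Proof. by case/andP: kap01 => /ltW -> ->. Qed.

Lemma path_version_unif_continuous : {ae P, forall w, forall e : R, 0 < e ->
  exists2 dl, 0 < dl & forall u v, 0 <= u <= 1 -> 0 <= v <= 1 -> `|u - v| < dl ->
  `|X u w - X v w| < e}.
Proof.
apply: filterS coefficients_decay => w [B B0 HB] e e0.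
exact: (series_path_unif_continuous pi a0 a1 (fun m k => eta m k w) K B kap
  hpart hsub hK kap01' B0 HB e e0).
Qed.

Lemma partial_sum_part n M s w : (n <= M)%N -> s \in pi n -> S M s w = S n s w.
Proof.
move=> nM sn; rewrite -(subnKC nM); elim: (M - n)%N => [|j IH]; first by rewrite addn0.
rewrite addnS -IH /partial_sum big_ord_recr /= addrA.
rewrite [X in _ + X]big1 ?addr0 // => k _.
by rewrite (schauder_part0 _ hpart hsub n) ?mulr0 // leq_addr.
Qed.

Lemma path_version_part n s w : s \in pi n -> X s w = S n s w.
Proof.
move=> sn; apply: cvg_lim => //; apply: cvg_near_cst.
by exists n => // M /= nM; exact: partial_sum_part.
Qed.

(** For [s] in [pi n] all stopped points lie in [pi n], so the mean square bound with [M = n]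
    applies to the limit path. *)
Lemma dqv_path_version n s w : s \in pi n ->
  dqv (pi n) (fun u => X u w) s = dqv (pi n) (fun u => S n u w) s.
Proof.
move=> sn; apply: eq_bigr => i _; rewrite !(path_version_part n) //.
  by case: leP => _ //; rewrite mem_nth_part // ltnW.
by case: leP => _ //; rewrite mem_nth_part.
Qed.

(** Geometric decay of the mesh makes the mean squared errors summable, and the countably many
    partition points share one null set. *)
Lemma path_version_qv : {ae P, forall w, forall m i, (i <= nint (pi m))%N ->
   dqv (pi n) (fun u => X u w) (pi m)`_i @[n --> \oo] --> (pi m)`_i}.
Proof.
apply: ae_foralln => m; apply: ae_foralln => i.
have [im|mi] := leqP i (nint (pi m)); last by exact: nearW.
set s := (pi m)`_i; have sm : s \in pi m by exact: mem_nth_part.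
have s01 : 0 <= s <= 1 by exact: part_itv sm.
pose f n w := (dqv (pi n) (fun u => S n u w) s - s) ^+ 2.
have mf n : measurable_fun setT (f n).
  apply: measurable_funX; apply: measurable_funB => //; apply: measurable_dqv => // u _.
  exact: measurable_partial_sum.
have f0 n w : 0 <= f n w by exact: sqr_ge0.
have r01 : 0 <= rho < 1 by case/andP: rho01 => /ltW -> ->.
have KD : 0 <= Kc * D by exact: mulr_ge0.
have If n : (\int[P]_w (f n w)%:E <= ((Kc * D) * rho ^+ n)%:E)%E.
  apply: (le_trans (dqvL2 n n s (leqnn n) s01)).
  by rewrite lee_fin -mulrA ler_wpM2l.
apply: filterS (ae_summable P f _ _ mf f0 r01 KD If) => w [fw _] _.
apply/cvgrPdist_lt => e e0; have e2 : 0 < e ^+ 2 by exact: exprn_gt0.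
have [N HN] := cvg_exN _ _ _ fw e2.
exists (maxn m N) => // n /=; rewrite geq_max => /andP[mn Nn].
rewrite distrC dqv_path_version; last exact: (sub_part _ hsub _ _ mn).
have := HN n Nn; rewrite subr0 ger0_norm // /f => h.
by rewrite -(@ltr_pXn2r _ 2) ?nnegrE ?(ltW e0) // real_normK ?num_real.
Qed.

(** A subsequence with mean squared error at most [2^-j] converges almost surely to [x t], while the
    full sequence converges almost surely to [X t]. *)
Lemma path_version_ae_eq (x : R -> Omega -> R) :
  (forall t : R, 0 <= t <= 1 -> measurable_fun setT (x t)) ->
  (forall t e : R, 0 <= t <= 1 -> 0 < e -> exists N, forall M, (N <= M)%N ->
    (\int[P]_w ((S M t w - x t w) ^+ 2)%:E <= e%:E)%E) ->
  forall t : R, 0 <= t <= 1 -> {ae P, forall w, X t w = x t w}.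
Proof.
move=> mx hx t t01.
have /choice[N HN] : forall j, exists N, forall M, (N <= M)%N ->
    (\int[P]_w ((S M t w - x t w) ^+ 2)%:E <= (2^-1 ^+ j)%:E)%E.
  by move=> j; apply: hx => //; rewrite exprn_gt0 // invr_gt0.
(* The index must exceed [N j] for the error bound and [j] in order to tend to infinity. *)
pose M j := maxn j (N j).
pose f j w := (S (M j) t w - x t w) ^+ 2.
have mf j : measurable_fun setT (f j).
  apply: measurable_funX; apply: measurable_funB; last exact: mx.
  exact: measurable_partial_sum.
have f0 j w : 0 <= f j w by exact: sqr_ge0.
have h01 : 0 <= (2^-1 : R) < 1 by apply/andP; split; lra.
have If j : (\int[P]_w (f j w)%:E <= (1 * 2^-1 ^+ j : R)%:E)%E.
  by rewrite mul1r; apply: HN; exact: leq_maxr.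
have fae := ae_summable P f _ _ mf f0 h01 ler01 If.
apply: filterS2 coefficients_decay fae => w [B B0 HB] [fw _].
have cX := series_path_cvg pi a0 a1 (fun m k => eta m k w) K B kap
  hpart hsub hK kap01' B0 HB t t01.
apply/eqP; rewrite -subr_eq0 -normr_le0 leNgt; apply/negP => e0.
set e := `|_| in e0; have e2 : 0 < e / 2 by rewrite divr_gt0.
have [N1 H1] := cvg_exN _ _ _ cX e2.
have e22 : 0 < (e / 2) ^+ 2 by exact: exprn_gt0.
have [N2 H2] := cvg_exN _ _ _ fw e22.
pose j := maxn N1 N2.
have := H1 (M j) (leq_trans (leq_maxl _ _) (leq_maxl _ _)).
have := H2 j (leq_maxr _ _); rewrite subr0 ger0_norm // /f => h.
have h' : `|S (M j) t w - x t w| < e / 2.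
  by rewrite -(@ltr_pXn2r _ 2) ?nnegrE ?(ltW e2) // real_normK ?num_real.
rewrite -/(partial_sum pi a0 a1 eta (M j) t w) -/(X t w) => h1.
have := ler_distD (S (M j) t w) (X t w) (x t w).
by rewrite [`|X t w - S _ _ _|]distrC -/e; lra.
Qed.

End PathRegularity.

(** * From epsilon estimates to topological formulations and back *)

Section QvLimit.
Context {R : realType}.

Lemma unif_continuous_within (X : R -> R) :
  (forall e : R, 0 < e -> exists2 dl, 0 < dl &
    forall u v, 0 <= u <= 1 -> 0 <= v <= 1 -> `|u - v| < dl -> `|X u - X v| < e) ->
  {within `[0, 1], continuous X}.
Proof.
move=> H; apply/subspace_continuousP => u /=; rewrite in_itv /= => u01.
apply/cvgrPdist_lt => e e0; have [dl dl0 Hdl] := H e e0.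
rewrite near_withinE; apply/nbhs_ballP; exists dl => // v /= uv.
by rewrite in_itv /= => v01; exact: Hdl.
Qed.

Lemma expectation_cvg0_le d (T : measurableType d) (P : probability T R) (f : nat -> T -> R) :
  (forall n w, 0 <= f n w) ->
  ('E_P[f n] @[n --> \oo] --> 0)%E ->
  forall e : R, 0 < e -> exists N, forall n, (N <= n)%N -> (\int[P]_w (f n w)%:E <= e%:E)%E.
Proof.
move=> f0 /fine_cvgP[[N1 _ H1] fc] e e0.
have [N2 H2] := cvg_exN _ _ _ fc e0.
exists (maxn N1 N2) => n; rewrite geq_max => /andP[n1 n2].
have := H1 n n1; rewrite /= unlock => fin; rewrite -(fineK fin) lee_fin.
have := H2 n n2; rewrite subr0 /= unlock => /ltW; apply: le_trans; exact: ler_norm.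
Qed.

End QvLimit.

Theorem mainTheorem10 (R : realType) (pi : nat -> seq R) (a0 a1 : R)
  (d : measure_display) (Omega : measurableType d) (P : probability Omega R)
  (eta : nat -> nat -> Omega -> R) (x : R -> Omega -> R) :
  finitely_refining pi ->
  (* the eta_{m,k} are real random variables *)
  (forall m k, (k < nlev pi m)%N -> measurable_fun setT (eta m k)) ->
  (* E eta_{m,k} = 0 *)
  (forall m k, (k < nlev pi m)%N -> ('E_P[eta m k] = 0)%E) ->
  (* E[eta_{m,k} eta_{m',k'}] = 1_{m=m'} 1_{k=k'} *)
  (forall m k m' k', (k < nlev pi m)%N -> (k' < nlev pi m')%N ->
     ('E_P[(fun w => eta m k w * eta m' k' w)%R]
        = ((m == m') && (k == k'))%:R%:E)%E) ->
  (* sup_{m,k} E eta_{m,k}^4 < oo *)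
  (exists C : R, forall m k, (k < nlev pi m)%N ->
     ('E_P[(fun w => eta m k w ^+ 4)%R] <= C%:E)%E) ->
  (* factorisation of fourth-order mixed moments over distinct indices *)
  (forall j1 j2 j3 j4 : nat * nat,
     (j1.2 < nlev pi j1.1)%N -> (j2.2 < nlev pi j2.1)%N ->
     (j3.2 < nlev pi j3.1)%N -> (j4.2 < nlev pi j4.1)%N ->
     j1 != j2 -> j1 != j3 -> j1 != j4 -> j2 != j3 -> j2 != j4 -> j3 != j4 ->
     forall al be ga de : nat, (al + be + ga + de = 4)%N ->
     ('E_P[(fun w => eta j1.1 j1.2 w ^+ al * eta j2.1 j2.2 w ^+ be
                    * eta j3.1 j3.2 w ^+ ga * eta j4.1 j4.2 w ^+ de)%R]
      = 'E_P[(fun w => eta j1.1 j1.2 w ^+ al)%R] * 'E_P[(fun w => eta j2.1 j2.2 w ^+ be)%R]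
        * 'E_P[(fun w => eta j3.1 j3.2 w ^+ ga)%R] * 'E_P[(fun w => eta j4.1 j4.2 w ^+ de)%R])%E) ->
  (* x(t) is (a version of) the L^2(P)-limit of the partial sums *)
  (forall t, t \in `[0, 1] -> measurable_fun setT (x t)) ->
  (forall t, t \in `[0, 1] ->
     ('E_P[(fun w => (partial_sum pi a0 a1 eta M t w - x t w) ^+ 2)%R]%E
        @[M --> \oo] --> 0%E)) ->
  (* conclusion 1: [x]_{pi^n}(t) -> t in probability *)
  (forall t, t \in `[0, 1] -> forall eps : R, 0 < eps ->
     P [set w | eps < `|dqv (pi n) (fun s => x s w) t - t| ] @[n --> \oo]
       --> 0%E)
  /\
  (* conclusion 2: under complete refining + balanced, a.s. x in Q_pi
     with [x]_pi(t) = t (for a version of x, necessarily the continuous one) *)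
  (complete_refining pi -> balanced pi ->
   exists X : R -> Omega -> R,
     (forall t, t \in `[0, 1] -> {ae P, forall w, X t w = x t w}) /\
     {ae P, forall w, inQ pi (fun s => X s w) /\ qv_limit pi (fun s => X s w) id}).
Proof.
move=> [hpart h0 hsub hmesh [K hK]] meta E1 E2 [C E4] Efac mx hx.
have C0 : 0 <= C.
  (* The fourth moment of any existing coefficient shows that [C] is nonnegative. *)
  have [j oj _] := fresh_index pi hpart hsub hmesh [::].
  rewrite -lee_fin (le_trans _ (E4 _ _ oj)) // unlock integral_ge0 // => w _.
  by rewrite lee_fin exprn_even_ge0.
pose Kc := 24 * (C + 1) + 12 * a1 ^+ 2 + 3 * (2 + a1 ^+ 2) ^+ 2.
have Kc0 : 0 <= Kc.
  have := sqr_ge0 a1; have := sqr_ge0 (2 + a1 ^+ 2); rewrite /Kc; lra.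
have L2 n M (t : R) (nM : (n <= M)%N) (t01 : 0 <= t <= 1) :=
  dqv_partial_sum_L2 pi a0 a1 P eta hpart hsub h0 hmesh meta E1 E2 C E4 Efac M n t nM t01.
have mx' t : 0 <= t <= 1 -> measurable_fun setT (x t).
  by move=> t01; apply: mx; rewrite in_itv.
have hx' (t e : R) : 0 <= t <= 1 -> 0 < e -> exists N, forall M, (N <= M)%N ->
    (\int[P]_w ((partial_sum pi a0 a1 eta M t w - x t w) ^+ 2)%:E <= e%:E)%E.
  move=> t01; apply: (expectation_cvg0_le _ _ P
    (fun M w => (partial_sum pi a0 a1 eta M t w - x t w) ^+ 2)).
    by move=> *; exact: sqr_ge0.
  by apply: hx; rewrite in_itv.
split.
  move=> t; rewrite in_itv /= => t01 eps eps0.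
  exact: (dqv_cvg_in_probability pi a0 a1 P eta Kc hpart hmesh meta L2 x mx' hx').
move=> cr bal.
have [D [rho [D0 rho01 hD]]] := mesh_geometric _ hpart cr.
have [Cb Cb0 hCb] := nint_mesh_bounded _ hpart bal.
have eta4 m k : (k < nlev pi m)%N -> (\int[P]_w (eta m k w ^+ 4)%:E <= C%:E)%E.
  by move=> km; have := E4 _ _ km; rewrite unlock.
(* The pathwise limit is a modification of [x] whose paths are almost surely continuous. *)
exists (path_version pi a0 a1 eta); split.
  move=> t; rewrite in_itv /= => t01.
  by apply: (path_version_ae_eq pi a0 a1 P eta C D rho Cb K).
have uc : {ae P, forall w, forall e : R, 0 < e -> exists2 dl, 0 < dl &
  forall u v, 0 <= u <= 1 -> 0 <= v <= 1 -> `|u - v| < dl ->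
  `|path_version pi a0 a1 eta u w - path_version pi a0 a1 eta v w| < e}.
  by apply: (path_version_unif_continuous pi a0 a1 P eta C D rho Cb K).
have qv : {ae P, forall w, forall m i, (i <= nint (pi m))%N ->
   dqv (pi n) (fun u => path_version pi a0 a1 eta u w) (pi m)`_i @[n --> \oo] --> (pi m)`_i}.
  by apply: (path_version_qv pi a0 a1 P eta Kc D rho).
apply: filterS2 uc qv => w ucw qvw.
have Q : qv_limit pi (fun s => path_version pi a0 a1 eta s w) id.
  split.
  - by apply: unif_continuous_within => e e0; exists e.
  - by [].
  - move=> e e0.
    have [N HN] := dqv_uniform pi _ hpart hsub hmesh ucw qvw e e0.
    by exists N => n Nn t; rewrite in_itv /= => t01; exact: HN.
split=> //; split; first exact: unif_continuous_within.
by exists id.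
Qed.
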